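(* For every integer $q\geq 5$ with $q\notin\{14,16,20\}$, there exists an extorthogonal double cover (extODC) of $K_{3q}$ by $qK_3$'s, and consequently $f(q,3)=3q-1$.
   Context: Let $X$ be a finite set of size $m$. A partition of $X$ is said to cover a subset $T\subseteq X$ if $T$ is contained in some part of the partition. An extorthogonal double cover (extODC) of the complete graph $K_m$ (with vertex set identified with $X$) is a set of partitions of $X$ such that (i) for any two (distinct) partitions in the set, there is at least one 2-subset of $X$ that is covered by both partitions; and (ii) each 2-subset of $X$ is covered by exactly two different partitions of the set. Viewing each part of a partition as a complete subgraph on that part, each partition is a disjoint union of complete graphs; an extODC of $K_{3q}$ by $qK_3$'s is one in which $|X|=3q$ and every partition consists of exactly $q$ parts, each of size 3. For integers $q,k>1$, a $(q,k,n)$-Armstrong code is a $q$-ary code $C$ (a set of words over an alphabet of size $q$) of length $n$ such that (i) $C$ has minimum Hamming distance at least $n-k+1$; and (ii) for any set of $k-1$ coordinates there exist two distinct codewords of $C$ that agree in exactly those coordinates. $f(q,k)$ denotes the maximum $n$ such that a $(q,k,n)$-Armstrong code exists. *)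

(* Defs.v *)
From mathcomp Require Import all_boot.

Set Implicit Arguments.
Unset Strict Implicit.
Unset Printing Implicit Defensive.

Definition covers (X : finType) (P : {set {set X}}) (T : {set X}) : bool :=
  [exists B in P, T \subset B].

(* Extorthogonal double cover of the complete graph on X; the complete
   subgraphs forming a member of the cover are the parts of a partition of X. *)
Definition extODC (X : finType) (D : {set {set {set X}}}) : Prop :=
  [/\ forall P, P \in D -> partition P [set: X],
      forall P Q, P \in D -> Q \in D -> P != Q ->
        exists T : {set X}, [/\ #|T| = 2, covers P T & covers Q T]
    & forall T : {set X}, #|T| = 2 -> #|[set P in D | covers P T]| = 2].

(* Every member of the cover is a disjoint union of c copies of K_r. *)
Definition extODC_by (X : finType) (c r : nat) (D : {set {set {set X}}}) : Prop :=
  extODC D /\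
  forall P, P \in D -> #|P| = c /\ forall B, B \in P -> #|B| = r.

Definition agree (A : eqType) (n : nat) (x y : n.-tuple A) : {set 'I_n} :=
  [set i | tnth x i == tnth y i].

Definition hamming (A : eqType) (n : nat) (x y : n.-tuple A) : nat :=
  #|[set i | tnth x i != tnth y i]|.

(* Meant for q, k > 1.  The bound n - k + 1 on the distance is an integer,
   hence is written without the truncated subtraction of nat. *)
Definition armstrong_code (q k n : nat) (C : {set n.-tuple 'I_q}) : Prop :=
  (forall x y, x \in C -> y \in C -> x != y -> n + 1 <= hamming x y + k) /\
  (forall S : {set 'I_n}, #|S| = k - 1 ->
     exists x y, [/\ x \in C, y \in C, x != y & agree x y = S]).

(* armstrong_max q k n means f(q, k) = n, where f(q, k) is the largest length
   of a (q, k, _)-Armstrong code; in particular the maximum exists. *)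
Definition armstrong_max (q k n : nat) : Prop :=
  (exists C : {set n.-tuple 'I_q}, armstrong_code k C) /\
  (forall n' (C : {set n'.-tuple 'I_q}), armstrong_code k C -> n' <= n).

(* Main.v *)
(* Idea. A partition into triples is encoded by the permutation rotating each of its triples, and
   an extODC of K_{3q} has 3q - 1 classes. Dropping two classes and the triple common to them
   leaves a cover of 3n = 3(q - 1) points with a hole of three points. Such holed covers are
   glued along frames: orthogonal double covers of the complete multipartite graph whose classes
   are indexed by the points, each class missing exactly the group of its index. Filling the groups
   of a frame with smaller holed covers gives a larger one. Frames in turn come from Wilson's
   fundamental construction: give weights to a transversal design and put on each block one of the
   frames of type 3^4, 3^5, 3^7, 3^8, 6^4 3^1, 6^5, 6^5 3^1, 6^6. Induction then reaches every
   n >= 4 outside {11, 13, 15, 19, 21, 27} from explicit small covers and frames, found by computer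
   with a prescribed cyclic symmetry. The orders q = 12, 22, 28 are treated directly: the first is cyclic
   on 35 points plus a fixed one, the others fill frames of type 2^24 17^1 and 2^30 23^1.

   The points of an extODC, read as words of block numbers, form an Armstrong code of length 3q - 1.
   Conversely let C be a (q, 3, n)-Armstrong code with n > 1 and M words. Pairs of coordinates are
   realised by distinct pairs of words, so n <= M; two words agree at most twice, and counting
   agreements coordinate by coordinate with Cauchy-Schwarz yields n M <= q (n + 2 (M - 1)). With
   n <= M this forces n < 3q. *)
Require Import Defs.
From Stdlib Require Import BinNat.
From mathcomp Require Import all_boot all_algebra all_field.
From mathcomp Require Import zify.

Set Implicit Arguments.
Unset Strict Implicit.
Unset Printing Implicit Defensive.

Delimit Scope N_scope with bn.
Delimit Scope nat_scope with N.

(** * Covers, frames and holes *)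

(** For distinct [x], [x'] and [f] of order three this says that they lie in one triple: one of them
    is the successor of the other. *)
Definition cov (X : eqType) (f : X -> X) (x x' : X) := (f x == x') || (f x' == x).

(* [s y] rotates the triples of the class [y] and fixes the points which the class misses.
   [fx y x] says that [y] misses [x], [U] holds for the pairs of points to be covered twice and
   [M] for the pairs of classes which must share a pair of points. *)
Record odc (X Y : eqType) (P : pred X) (C : pred Y) (fx : Y -> X -> bool)
    (U : rel X) (M : rel Y) (s : Y -> X -> X) : Prop := Odc {
  odc_in : forall y x, C y -> P x -> P (s y x);
  odc_cube : forall y x, C y -> P x -> s y (s y (s y x)) = x;
  odc_fix : forall y x, C y -> P x -> (s y x == x) = fx y x;
  odc_two : forall x x', P x -> P x' -> U x x' ->
    exists y1 y2, [/\ C y1, C y2, y1 != y2 &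
      forall y, C y -> cov (s y) x x' = (y == y1) || (y == y2)];
  odc_none : forall y x x', C y -> P x -> P x' -> x != x' -> ~~ U x x' ->
    ~~ cov (s y) x x';
  odc_meet : forall y y', C y -> C y' -> M y y' ->
    exists x x', [/\ P x, P x', x != x', cov (s y) x x' & cov (s y') x x'] }.

(** Bijections on points and on classes carry a cover along. They need to be mutually inverse only
    on the carriers, so covers can move freely between naturals, pairs, binary codes and
    ordinals. *)
Lemma odc_transport (X Y X' Y' : eqType) (P : pred X) (C : pred Y) fx U M s
    (P' : pred X') (C' : pred Y') fx' U' M'
    (f : X -> X') (f' : X' -> X) (h : Y -> Y') (h' : Y' -> Y) :
    (forall x, P x -> P' (f x) /\ f' (f x) = x) ->
    (forall z, P' z -> P (f' z) /\ f (f' z) = z) ->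
    (forall y, C y -> C' (h y) /\ h' (h y) = y) ->
    (forall w, C' w -> C (h' w) /\ h (h' w) = w) ->
    (forall w z, C' w -> P' z -> fx (h' w) (f' z) = fx' w z) ->
    (forall z z', P' z -> P' z' -> U (f' z) (f' z') = U' z z') ->
    (forall w w', C' w -> C' w' -> M (h' w) (h' w') = M' w w') ->
  odc P C fx U M s ->
  odc P' C' fx' U' M' (fun w z => f (s (h' w) (f' z))).
Proof.
move=> Pf Pf' Ch Ch' Efx EU EM [sin scub sfix stwo snone smeet].
have finj x x' : P x -> P x' -> (f x == f x') = (x == x').
  move=> px px'; apply/eqP/eqP => [E|->] //.
  by rewrite -(Pf _ px).2 E (Pf _ px').2.
have key a z' : P a -> P' z' -> (f a == z') = (a == f' z').
  by move=> pa pz'; rewrite -{1}(Pf' _ pz').2 finj //; exact: (Pf' _ pz').1.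
have Ecov w z z' : C' w -> P' z -> P' z' ->
    cov (fun z => f (s (h' w) (f' z))) z z' = cov (s (h' w)) (f' z) (f' z').
  move=> /Ch'[cw _] pz pz'; have [[pz1 _] [pz1' _]] := (Pf' _ pz, Pf' _ pz').
  by rewrite /cov !key //; exact: sin.
have f'inj z z' : P' z -> P' z' -> (f' z == f' z') = (z == z').
  move=> pz pz'; apply/eqP/eqP => [E|->] //.
  by rewrite -(Pf' _ pz).2 E (Pf' _ pz').2.
split.
- move=> w z /Ch'[cw _] /Pf'[pz _]; exact: (Pf _ (sin _ _ cw pz)).1.
- move=> w z /Ch'[cw _] /Pf'[pz E].
  have p1 := sin _ _ cw pz; have p2 := sin _ _ cw p1.
  by rewrite (Pf _ p1).2 (Pf _ p2).2 scub.
- move=> w z cw pz; rewrite -Efx //.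
  have [[cw1 _] [pz1 Ez]] := (Ch' _ cw, Pf' _ pz).
  by rewrite key ?sfix //; exact: sin.
- move=> z z' pz pz'; rewrite -EU // => u.
  have [[pz1 Ez] [pz'1 Ez']] := (Pf' _ pz, Pf' _ pz').
  have [y1 [y2 [c1 c2 ne E]]] := stwo _ _ pz1 pz'1 u.
  exists (h y1), (h y2); have [[c1' E1] [c2' E2]] := (Ch _ c1, Ch _ c2).
  split=> //; first by apply: contra ne => /eqP Eh; rewrite -E1 Eh E2.
  move=> w cw; have [cw1 Ew] := Ch' _ cw.
  rewrite Ecov // E //.
  have hE y : C y -> (h' w == y) = (w == h y).
    move=> cy; apply/eqP/eqP => [<-|->]; [by rewrite Ew | exact: (Ch _ cy).2].
  by rewrite !hE.
- move=> w z z' cw pz pz' ne; rewrite -EU // => nu.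
  rewrite Ecov //; apply: snone => //; rewrite ?f'inj //.
  + exact: (Ch' _ cw).1.
  + exact: (Pf' _ pz).1.
  + exact: (Pf' _ pz').1.
- move=> w w' cw cw'; rewrite -EM // => m.
  have [[cw1 _] [cw1' _]] := (Ch' _ cw, Ch' _ cw').
  have [x [x' [px px' ne c1 c2]]] := smeet _ _ cw1 cw1' m.
  have [[px1 E1] [px1' E1']] := (Pf _ px, Pf _ px').
  exists (f x), (f x'); split; rewrite ?finj ?Ecov ?E1 ?E1' //.
Qed.

(** One predicate serves for points and classes, since classes are indexed by points. Pairs of
    points and pairs of classes within one group are left to the covers that later fill the
    groups. *)
Definition frame (X I : eqType) (P : pred X) (g : X -> I) s :=
  odc P P (fun y x => g y == g x) (fun x x' => g x != g x')
    (fun y y' => g y != g y') s.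

(** The fixed points of [s y] are exactly the group of [y]. A map of order three cannot send a moved
    point to a fixed one. *)
Lemma frame_move (X I : eqType) (P : pred X) (g : X -> I) s y x :
  frame P g s -> P y -> P x -> g y != g x -> g y != g (s y x).
Proof.
move=> F py px; have pi := odc_in F py px.
rewrite -(odc_fix F py px) -(odc_fix F py pi); apply: contra => /eqP E.
by have := odc_cube F py px; rewrite !E => E1; rewrite E1.
Qed.

(* [inl] points and classes are the ordinary ones; [inr i] with [i < h] are the points of the hole,
   and [inr j] with [j < k] the classes missing the hole. *)
Definition isr (X Y : Type) (z : X + Y) := if z is inr _ then true else false.
Definition ext (X : Type) (h : nat) (P : pred X) : pred (X + nat) :=
  fun z => match z with inl x => P x | inr i => i < h end.
Definition holed (h k : nat) (X : eqType) (P : pred X) s :=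
  odc (ext h P) (ext k P) (fun y x => isr y && isr x)
    (fun x x' => (x != x') && ~~ (isr x && isr x'))
    (fun y y' => (y != y') && ~~ (isr y && isr y')) s.

(** * Filling the groups of a frame *)

Section Fill.
Variables (h k : nat) (X I : eqType) (P : pred X) (g : X -> I).
Variables (s : X -> X -> X) (t : I -> X + nat -> X + nat -> X + nat).
Hypothesis sF : frame P g s.
Hypothesis tH : forall i, holed h k (fun x => P x && (g x == i)) (t i).

(** The frame acts between different groups, the small cover [t] inside a group together with the
    hole. A class missing the hole is thus pieced together from the corresponding classes of all
    groups. *)
Definition fill (y x : X + nat) : X + nat :=
  match y, x with
  | inl a, inl b => if g a == g b then t (g a) (inl a) (inl b) else inl (s a b)
  | inl a, inr _ => t (g a) y x
  | inr _, inl b => t (g b) y x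
  | inr _, inr _ => x
  end.

Let G i x := P x && (g x == i).

Lemma fill_in_group i y x : ext k (G i) y -> ext h (G i) x ->
  fill y x = if isr y && isr x then x else t i y x.
Proof.
case: y x => [a|j] [b|l] //=.
- by move=> /andP[_ /eqP->] /andP[_ /eqP->]; rewrite eqxx.
- by move=> /andP[_ /eqP->].
- by move=> _ /andP[_ /eqP->].
Qed.

(** The clause of [fill] for two hole arguments agrees with every [t i], because a class missing the
    hole fixes the hole points. *)
Lemma fill_group i y x : ext k (G i) y -> ext h (G i) x -> fill y x = t i y x.
Proof.
move=> cy px; rewrite (fill_in_group cy px).
case E: (isr y && isr x) => //.
by apply/esym/eqP; rewrite (odc_fix (tH i) cy px) E.
Qed.

Lemma fill_cross a b : P a -> P b -> g a != g b -> fill (inl a) (inl b) = inl (s a b).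
Proof. by move=> _ _ /= /negPf->. Qed.

Lemma cov_group i y x x' : ext k (G i) y -> ext h (G i) x -> ext h (G i) x' ->
  cov (fill y) x x' = cov (t i y) x x'.
Proof. by move=> *; rewrite /cov !(@fill_group i). Qed.

Lemma extS (n : nat) i z : ext n (G i) z -> ext n P z.
Proof. by case: z => //= x /andP[]. Qed.

Lemma extN (n : nat) i z d : ext n (G i) z -> g d != i -> (z == inl d) = false.
Proof.
by case: z => //= w /andP[_ /eqP gw] gd; apply: contraNF gd => /eqP[<-]; apply/eqP.
Qed.

Lemma fill_hole_in i y x : ext k (G i) y -> ext h (G i) x -> ext h (G i) (fill y x).
Proof. by move=> cy px; rewrite (fill_group cy px); exact: (odc_in (tH i) cy px). Qed.

(** Outside its own group [a] acts by the frame, which covers no pair inside a group and fixes no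
    point there. On the hole it acts by the small cover of its own group, so it never reaches group
    [i]. *)
Lemma cov_other a i x x' : P a -> g a != i -> ext h (G i) x -> ext h (G i) x' ->
  ~~ (isr x && isr x') -> ~~ cov (fill (inl a)) x x'.
Proof.
move=> pa ne.
have key z l : P z -> g z = i -> inl (s a z) != inr l :> X + nat by [].
have inner z z' : P z -> g z = i -> P z' -> g z' = i -> s a z != z'.
  move=> pz gz pz' gz'; apply/eqP => E.
  have := @odc_none _ _ _ _ _ _ _ _ sF a z z' pa pz pz'; rewrite gz gz' eqxx /cov E eqxx /=.
  case: (z =P z') => [Ez|_] H; last by have := H isT isT.
  have := odc_fix sF pa pz; rewrite E Ez eqxx gz' => /esym/eqP Eg.
  by rewrite Eg eqxx in ne.
have outer z l : P z -> g z = i -> l < h -> fill (inl a) (inr l) != inl z.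
  move=> pz gz lh; rewrite (@extN h (g a)) ?gz 1?eq_sym //.
  by apply: fill_hole_in; rewrite //= /G pa eqxx.
case: x x' => [z|l] [z'|l'] //= hz hz' _; rewrite /cov.
- have [/andP[pz /eqP gz] /andP[pz' /eqP gz']] := (hz, hz').
  rewrite !fill_cross ?gz ?gz' //.
  by rewrite negb_or; apply/andP; split; apply/negP => /eqP[] /eqP; apply/negP; apply: inner.
- have /andP[pz /eqP gz] := hz.
  by rewrite fill_cross ?gz // negb_or outer.
- have /andP[pz /eqP gz] := hz'.
  by rewrite (@fill_cross a z') ?gz // negb_or outer.
Qed.

(** A pair outside the hole either lies in one group extended by the hole, where the small cover
    decides, or crosses two groups, where the frame decides. The same split is made for pairs of
    classes. *)
Lemma fillP : holed h k P fill.
Proof.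
have Gg x : P x -> ext h (G (g x)) (inl x) by move=> px; rewrite /= /G px eqxx.
have Gc x : P x -> ext k (G (g x)) (inl x) by move=> px; rewrite /= /G px eqxx.
have dich y x : ext k P y -> ext h P x ->
    (exists i, ext k (G i) y /\ ext h (G i) x) \/
    (isr y && isr x) \/
    (exists a b, [/\ y = inl a, x = inl b, P a, P b & g a != g b]).
  case: y x => [a|j] [b|l] /= cy px.
  - case: (altP (g a =P g b)) => [E|ne]; last by right; right; exists a, b.
    by left; exists (g a); rewrite /G cy px E eqxx.
  - by left; exists (g a); rewrite /G cy eqxx.
  - by left; exists (g b); rewrite /G px eqxx.
  - by right; left.
have dichx x x' : ext h P x -> ext h P x' -> ~~ (isr x && isr x') ->
    (exists i, ext h (G i) x /\ ext h (G i) x') \/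
    (exists a b, [/\ x = inl a, x' = inl b, P a, P b & g a != g b]).
  case: x x' => [a|j] [b|l] //= cy px _.
  - case: (altP (g a =P g b)) => [E|ne]; last by right; exists a, b.
    by left; exists (g a); rewrite /G cy px E eqxx.
  - by left; exists (g a); rewrite /G cy eqxx.
  - by left; exists (g b); rewrite /G px eqxx.
(* If [b] belongs to the group of one end, the frame fixes that end, while [fill] keeps it in its
   group or the hole. Neither map then takes it to the other end. *)
have cov_cross a a' b : P b -> P a -> P a' -> g a != g a' ->
    cov (fill (inl b)) (inl a) (inl a') = cov (s b) a a'.
  move=> pb pa pa' ne; rewrite /cov.
  have half c d : P c -> P d -> g c != g d -> (fill (inl b) (inl c) == inl d) = (s b c == d).
    move=> pc pd nc; have [E|nb] := altP (g b =P g c); last by rewrite fill_cross.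
    have := odc_fix sF pb pc; rewrite E eqxx => /eqP->.
    have -> : (c == d) = false by apply: contraNF nc => /eqP->.
    apply: (@extN h (g c)); last by rewrite eq_sym.
    by apply: fill_hole_in; rewrite ?Gg //= /G pb E eqxx.
  by rewrite !half // eq_sym.
split.
- move=> y x cy px; case: (dich _ _ cy px) => [[i [ci xi]]|[|[a [b [-> -> pa pb ne]]]]].
  + by rewrite (fill_group ci xi); apply: (@extS _ i); exact: (odc_in (tH i) ci xi).
  + by case: y x cy px => [a|j] [b|l].
  + by rewrite fill_cross //=; apply: (odc_in sF).
- move=> y x cy px; case: (dich _ _ cy px) => [[i [ci xi]]|[|[a [b [-> -> pa pb ne]]]]].
  + have x1 := odc_in (tH i) ci xi; have x2 := odc_in (tH i) ci x1.
    by rewrite (fill_group ci xi) (fill_group ci x1) (fill_group ci x2) (odc_cube (tH i)).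
  + by case: y x cy px => [a|j] [b|l].
  + have p1 := odc_in sF pa pb; have p2 := odc_in sF pa p1.
    have n1 := frame_move sF pa pb ne; have n2 := frame_move sF pa p1 n1.
    by rewrite fill_cross // fill_cross // fill_cross // (odc_cube sF).
- move=> y x cy px; case: (dich _ _ cy px) => [[i [ci xi]]|[|[a [b [-> -> pa pb ne]]]]].
  + by rewrite (fill_group ci xi) (odc_fix (tH i)).
  + by case: y x cy px => [a|j] [b|l] //= _ _ _; rewrite eqxx.
  + by rewrite fill_cross //= (inj_eq (@inl_inj _ _)) (odc_fix sF) // (negPf ne).
- move=> x x' px px' /andP[ne nr].
  case: (dichx _ _ px px' nr) => [[i [xi xi']]|[a [b [-> -> pa pb ng]]]].
  + have [|y1 [y2 [c1 c2 n12 E]]] := odc_two (tH i) xi xi'; first by rewrite ne nr.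
    exists y1, y2; split=> //; try exact: (@extS _ i).
    move=> y cy; case yi: (ext k (G i) y); first by rewrite (cov_group yi xi xi') E.
    case: y cy yi => [a /= pa|j /= jk]; last by rewrite jk.
    rewrite /G pa /= => /negbT ga; rewrite (negPf (cov_other pa ga xi xi' nr)).
    have ney z : ext k (G i) z -> inl a == z = false.
      by case: z => //= z /andP[_ /eqP gz]; apply: contraNF ga => /eqP[->]; apply/eqP.
    by rewrite !ney.
  + have [y1 [y2 [c1 c2 n12 E]]] := odc_two sF pa pb ng.
    exists (inl y1), (inl y2); split=> // -[c pc|j jk]; first by rewrite cov_cross // E.
    (* A class missing the hole keeps each point in its group or the hole, so it covers no crossing
       pair. *)
    have hol c d : P c -> P d -> g c != g d -> fill (inr j) (inl c) == inl d = false.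
      move=> pc pd nc; apply: (@extN h (g c)); last by rewrite eq_sym.
      by apply: fill_hole_in; rewrite ?Gg.
    by rewrite /cov !hol // eq_sym.
- move=> y x x' cy px px' ne /nandP[|]; first by rewrite ne.
  rewrite negbK => /andP[rx rx'].
  case: y x x' cy px px' ne rx rx' => [a|j] [//|l] [//|l'] /= cy px px' ne _ _.
    rewrite (@cov_group (g a)) ?Gc //=.
    by apply: (odc_none (tH (g a))) => //=; rewrite ?cy ?eqxx // andbF.
  by rewrite /cov /= orbC eq_sym orbb.
- move=> y y' cy cy' /andP[ne nr].
  have [[i [yi yi']]|[a [b [-> -> pa pb ng]]]] :
    (exists i, ext k (G i) y /\ ext k (G i) y') \/
    (exists a b, [/\ y = inl a, y' = inl b, P a, P b & g a != g b]).
  + case: y y' cy cy' nr {ne} => [a|j] [b|l] //= cy px _.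
    - case: (altP (g a =P g b)) => [E|ne]; last by right; exists a, b.
      by left; exists (g a); rewrite /G cy px E eqxx.
    - by left; exists (g a); rewrite /G cy eqxx.
    - by left; exists (g b); rewrite /G px eqxx.
  + have [|x [x' [xi xi' nx c1 c2]]] := odc_meet (tH i) yi yi'; first by rewrite ne nr.
    exists x, x'; split=> //; try exact: (@extS _ i); by rewrite (@cov_group i).
  + have [x [x' [px px' nx c1 c2]]] := odc_meet sF pa pb ng.
    have ngx : g x != g x'.
      by apply: contraTN c1 => E; apply: (odc_none sF) => //; rewrite negbK.
    by exists (inl x), (inl x'); split; rewrite ?cov_cross.
Qed.
End Fill.

(** * Wilson's fundamental construction *)

(* A transversal design: the block [b] meets the group [c] in the point [L c b], and [J c x c' x']
   is the block through the point [x] of the group [c] and the point [x'] of the group [c']. *)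
Record td (k m : nat) (B : Type) (L : nat -> B -> nat)
    (J : nat -> nat -> nat -> nat -> B) : Prop := Td {
  td_lt : forall c b, c < k -> L c b < m;
  td_on : forall c x c' x', c < k -> c' < k -> c != c' -> x < m -> x' < m ->
    L c (J c x c' x') = x /\ L c' (J c x c' x') = x';
  td_uniq : forall c c' b, c < k -> c' < k -> c != c' -> J c (L c b) c' (L c' b) = b }.

(** The canonical point set for a frame with groups of sizes [3 * w_i]: the pair [(i, e)] is point
    [e] of group [i]. Weight zero gives an empty group. *)
Definition ptype (w : seq nat) : pred (nat * nat) :=
  fun p => (p.1 < size w) && (p.2 < 3 * nth 0 w p.1).

Section Wfc.
Variables (k m : nat) (B : Type) (L : nat -> B -> nat).
Variables (J : nat -> nat -> nat -> nat -> B) (wt : nat -> nat -> nat).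
Hypothesis T : td k m L J.

Definition pattern (b : B) := [seq wt c (L c b) | c <- iota 0 k].

Variable t : seq nat -> nat * nat -> nat * nat -> nat * nat.
Hypothesis tF : forall b, frame (ptype (pattern b)) fst (t (pattern b)).

(* [((c, z), e)] is the copy number [e] of the point [z] of the group [c]. *)
Let X := ((nat * nat) * nat)%type.
Definition wpt : pred X := fun p =>
  [&& p.1.1 < k, p.1.2 < m & p.2 < 3 * wt p.1.1 p.1.2].

Definition emb (b : B) (u : nat * nat) : X := ((u.1, L u.1 b), u.2).
Definition join (y x : X) := J y.1.1 y.1.2 x.1.1 x.1.2.

(** A class and a point over different groups determine a block, and the ingredient frame placed on
    that block acts. The class fixes everything over its own group. *)
Definition wfc (y x : X) : X :=
  if y.1.1 == x.1.1 then x else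
  emb (join y x) (t (pattern (join y x)) (y.1.1, y.2) (x.1.1, x.2)).

Lemma ptypeE b u : ptype (pattern b) u = wpt (emb b u).
Proof.
rewrite /ptype /wpt /= size_map size_iota; case ku: (u.1 < k) => //=.
by rewrite (td_lt T) // (nth_map 0) ?size_iota // nth_iota.
Qed.

Lemma emb_inj b u v : (emb b u == emb b v) = (u == v).
Proof.
apply/eqP/eqP => [|-> //]; case: u v => [a e] [c f]; rewrite /emb /=.
by case=> -> _ ->.
Qed.

(** Over a single block the construction is a copy of the ingredient frame. This includes the case
    of one common group, where both maps fix the point. *)
Lemma wfc_emb b u v : wpt (emb b u) -> wpt (emb b v) ->
  wfc (emb b u) (emb b v) = emb b (t (pattern b) u v).
Proof.
move=> pu pv; rewrite /wfc /=.
case: (altP (u.1 =P v.1)) => [E|ne].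
  have := odc_fix (tF b) (y := u) (x := v).
  by rewrite !ptypeE => /(_ pu pv); rewrite E eqxx => /eqP->.
have /and3P[ku _ _] := pu; have /and3P[kv _ _] := pv.
rewrite /join /= (td_uniq T) //; by case: u v {pu pv ne ku kv} => [? ?] [? ?].
Qed.

Lemma embE x x' : wpt x -> wpt x' -> x.1.1 != x'.1.1 ->
  x = emb (join x x') (x.1.1, x.2) /\ x' = emb (join x x') (x'.1.1, x'.2).
Proof.
case: x x' => [[c z] e] [[c' z'] e'] /= /and3P[/= kc mz _] /and3P[/= kc' mz' _] ne.
by rewrite /emb /join /=; have [-> ->] := td_on T kc kc' ne mz mz'.
Qed.

Lemma join_emb b u v : wpt (emb b u) -> wpt (emb b v) -> u.1 != v.1 ->
  join (emb b u) (emb b v) = b.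
Proof. by move=> /and3P[ku _ _] /and3P[kv _ _] ne; rewrite /join /= (td_uniq T). Qed.

Lemma cov_emb b u v v' : wpt (emb b u) -> wpt (emb b v) -> wpt (emb b v') ->
  cov (wfc (emb b u)) (emb b v) (emb b v') = cov (t (pattern b) u) v v'.
Proof. by move=> *; rewrite /cov !wfc_emb // !emb_inj. Qed.

Lemma wfc_in_block y x : wpt y -> wpt x -> y.1.1 != x.1.1 ->
  exists2 q, wfc y x = emb (join y x) q & q.1 != y.1.1.
Proof.
move=> py px ne; have [Ey Ex] := embE py px ne.
exists (t (pattern (join y x)) (y.1.1, y.2) (x.1.1, x.2)).
  by rewrite /wfc (negPf ne).
have := @frame_move _ _ _ _ _ (y.1.1, y.2) (x.1.1, x.2) (tF (join y x)).
by rewrite !ptypeE -Ey -Ex => H; rewrite eq_sym; exact: H.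
Qed.

Lemma join_sym x x' : wpt x -> wpt x' -> x.1.1 != x'.1.1 -> join x x' = join x' x.
Proof.
move=> px px' ne; have [Ex Ex'] := embE px px' ne.
by rewrite {2}Ex' {3}Ex join_emb -?Ex' -?Ex // eq_sym.
Qed.

(** A class moves a point only within the block that joins them. A covered pair across two groups
    therefore already determines the block, and the class lies over it. *)
Lemma cov_on_block y x x' : wpt y -> wpt x -> wpt x' -> x.1.1 != x'.1.1 ->
  cov (wfc y) x x' -> y = emb (join x x') (y.1.1, y.2).
Proof.
have half z z' : wpt y -> wpt z -> wpt z' -> z.1.1 != z'.1.1 -> wfc y z = z' ->
    y = emb (join z z') (y.1.1, y.2).
  move=> py pz pz' ne E; have [e|nz] := eqVneq y.1.1 z.1.1.
    by move: E; rewrite /wfc e eqxx => E; rewrite E eqxx in ne.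
  have [q Eq nq] := wfc_in_block py pz nz; have [Ey Ez] := embE py pz nz.
  have := @join_emb (join y z) (z.1.1, z.2) q; rewrite -Ez -Eq E => -> //.
  by move: ne; rewrite -E Eq.
move=> py px px' ne /orP[/eqP E|/eqP E]; first exact: half E.
by rewrite join_sym //; apply: half E; rewrite // eq_sym.
Qed.

Lemma block_through x x' : wpt x -> wpt x' -> x.1.1 != x'.1.1 ->
  exists b u v, [/\ x = emb b u, x' = emb b v & u.1 != v.1].
Proof.
move=> px px' ne; have [Ex Ex'] := embE px px' ne.
by exists (join x x'), (x.1.1, x.2), (x'.1.1, x'.2).
Qed.

Lemma wfcP : frame wpt (fun p : X => p.1.1) wfc.
Proof.
split.
- move=> y x py px; have [e|ne] := eqVneq y.1.1 x.1.1; first by rewrite /wfc e eqxx.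
  have [b [u [v [Ey Ex nuv]]]] := block_through py px ne; subst.
  by rewrite wfc_emb // -ptypeE; apply: (odc_in (tF _)); rewrite ptypeE.
- move=> y x py px; have [e|ne] := eqVneq y.1.1 x.1.1; first by rewrite /wfc !e !eqxx.
  have [b [u [v [Ey Ex nuv]]]] := block_through py px ne; subst.
  move: (py) (px); rewrite -!ptypeE => qu qv.
  have q1 := odc_in (tF _) qu qv; have q2 := odc_in (tF _) qu q1.
  by rewrite !wfc_emb -?ptypeE // (odc_cube (tF _)).
- move=> y x py px; have [e|ne] := eqVneq y.1.1 x.1.1; first by rewrite /wfc !e !eqxx.
  have [b [u [v [Ey Ex nuv]]]] := block_through py px ne; subst.
  by rewrite wfc_emb // emb_inj (odc_fix (tF _)) ?ptypeE // (negPf nuv).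
- move=> x x' px px' ne.
  have [b [u [v [Ex Ex' nuv]]]] := block_through px px' ne; subst.
  have qu : ptype (pattern b) u by rewrite ptypeE.
  have qv : ptype (pattern b) v by rewrite ptypeE.
  have [y1 [y2 [c1 c2 n12 E]]] := odc_two (tF b) qu qv nuv.
  exists (emb b y1), (emb b y2); rewrite -!ptypeE emb_inj; split=> // y py.
  (* Classes over the block through the pair are governed by its frame; a class off the block cannot
     cover the pair. *)
  have [Ly|Ly] := altP (L y.1.1 b =P y.1.2).
    have Ey : y = emb b (y.1.1, y.2).
      by case: y py Ly => [[c z] e] /= _; rewrite /emb /= => ->.
    by move: py; rewrite Ey => py; rewrite cov_emb // !emb_inj E // ptypeE.
  have out w : y == emb b w = false by apply: contraNF Ly => /eqP->.
  rewrite !out; apply: contraNF Ly => /(cov_on_block py px px' ne).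
  by rewrite join_emb // => ->.
- move=> y x x' py px px' nx; rewrite negbK => /eqP e.
  have [ey|ne] := eqVneq y.1.1 x.1.1.
    by rewrite /cov /wfc -e ey eqxx eq_sym orbb eq_sym.
  (* Moving [z] to another point over the same group would make the ingredient frame cover a pair
     inside one of its groups. *)
  have half z z' : wpt z -> wpt z' -> z != z' -> z.1.1 = z'.1.1 -> y.1.1 != z.1.1 ->
      wfc y z != z'.
    move=> pz pz' nz ez nyz.
    have [b [u [v [Ey Ez nuv]]]] := block_through py pz nyz; subst.
    rewrite wfc_emb //; apply/eqP => E.
    set q := t _ u v in E; rewrite -E emb_inj in nz; rewrite -E in pz' ez.
    have /negP[] : ~~ cov (t (pattern b) u) v q.
      by apply: (odc_none (tF b)); rewrite ?ptypeE // negbK; apply/eqP.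
    by rewrite /cov -/q eqxx.
  by rewrite /cov negb_or !half // -?e // eq_sym.
- move=> y y' py py' ne.
  have [b [u [v [Ey Ey' nuv]]]] := block_through py py' ne; subst.
  have qu : ptype (pattern b) u by rewrite ptypeE.
  have qv : ptype (pattern b) v by rewrite ptypeE.
  have [x [x' [px px' nx c1 c2]]] := odc_meet (tF b) qu qv nuv.
  exists (emb b x), (emb b x'); rewrite -!ptypeE !cov_emb -?ptypeE // emb_inj.
  by split.
Qed.
End Wfc.

(** * Orders of holed covers *)

(** There are [n] ordinary points and [n] ordinary classes. A hole of one point contains no pair, so
    [fillable 1 0 n] is a complete cover of [n + 1] points by [n] classes. *)
Definition fillable (h k n : nat) : Prop := exists s, holed h k (fun x : nat => x < n) s.

Lemma holed_transport h k (X X' : eqType) (P : pred X) (P' : pred X') s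
    (f : X -> X') (f' : X' -> X) :
    (forall x, P x -> P' (f x) /\ f' (f x) = x) ->
    (forall z, P' z -> P (f' z) /\ f (f' z) = z) ->
  holed h k P s -> exists s', holed h k P' s'.
Proof.
move=> Pf Pf' H.
pose F (A B : Type) (u : A -> B) (z : A + nat) : B + nat :=
  match z with inl x => inl (u x) | inr i => inr i end.
have FP n x : ext n P x -> ext n P' (F _ _ f x) /\ F _ _ f' (F _ _ f x) = x.
  by case: x => //= x /Pf[? ->].
have FP' n x : ext n P' x -> ext n P (F _ _ f' x) /\ F _ _ f (F _ _ f' x) = x.
  by case: x => //= x /Pf'[? ->].
have Fr z : isr (F _ _ f' z) = isr z by case: z.
have Fe n n' z z' : ext n P' z -> ext n' P' z' -> (F _ _ f' z == F _ _ f' z') = (z == z').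
  move=> pz pz'; apply/eqP/eqP => [E|-> //].
  by have [_ <-] := FP' _ _ pz; rewrite E; have [_ ->] := FP' _ _ pz'.
eexists; apply: (odc_transport (f := F _ _ f) (f' := F _ _ f') (h := F _ _ f)
  (h' := F _ _ f') _ _ _ _ _ _ _ H); try exact: FP; try exact: FP'.
- by move=> w z _ _; rewrite !Fr.
- by move=> z z' pz pz'; rewrite !Fr (Fe h h).
- by move=> z z' pz pz'; rewrite !Fr (Fe k k).
Qed.

Lemma fillable_list h k (X : eqType) (x0 : X) (l : seq X) (P : pred X) :
  uniq l -> (forall x, P x = (x \in l)) -> fillable h k (size l) ->
  exists s, holed h k P s.
Proof.
move=> ul El [s H]; apply: (holed_transport (f := nth x0 l) (f' := index ^~ l) _ _ H).
- by move=> x lx; rewrite El mem_nth // index_uniq.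
- by move=> z; rewrite El => lz; rewrite index_mem nth_index.
Qed.

Lemma list_fillable h k (X : eqType) (x0 : X) (l : seq X) (P : pred X) s :
  uniq l -> (forall x, P x = (x \in l)) -> holed h k P s -> fillable h k (size l).
Proof.
move=> ul El H; apply: (holed_transport (f := index ^~ l) (f' := nth x0 l) _ _ H).
- by move=> z; rewrite El => lz; rewrite index_mem nth_index.
- by move=> x lx; rewrite El mem_nth // index_uniq.
Qed.

Lemma holed_empty h k (X : eqType) (P : pred X) :
  (forall x, P x = false) -> holed h k P (fun _ x => x).
Proof.
move=> E; split=> //.
- by move=> [y|j] [x|i] /=; rewrite ?E // eqxx.
- by move=> [x|i] [x'|j] /=; rewrite ?E // andbF.
- by move=> y x x' _ _ _ ne _; rewrite /cov (negPf ne) eq_sym (negPf ne).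
- by move=> [y|i] [y'|j] /=; rewrite ?E // andbF.
Qed.

Lemma fillable0 h k : fillable h k 0.
Proof. by exists (fun _ x => x); apply: holed_empty. Qed.

(** Only finitely many indices are served, so induction replaces a choice principle. *)
Lemma nat_choice (T : Type) (R : nat -> T -> Prop) K :
  (forall c, exists t, R c t) -> exists f, forall c, c < K -> R c (f c).
Proof.
move=> H; elim: K => [|K [f Hf]]; first by have [t _] := H 0; exists (fun _ => t).
have [t Ht] := H K; exists (fun c => if c == K then t else f c) => c.
by rewrite ltnS leq_eqVlt; case: eqP => [-> _|_ /= /Hf].
Qed.

Lemma fillable_frame h k (X : eqType) (x0 : X) (P : pred X) (g : X -> nat) s K
    (grp : nat -> seq X) :
    frame P g s -> (forall x, P x -> g x < K) ->
    (forall c, uniq (grp c)) ->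
    (forall c x, (x \in grp c) = P x && (g x == c)) ->
    (forall c, c < K -> fillable h k (size (grp c))) ->
  fillable h k (sumn [seq size (grp c) | c <- iota 0 K]).
Proof.
move=> F gK ug Eg AK.
have AA c : exists t, holed h k (fun x => P x && (g x == c)) t.
  have [cK|cK] := ltnP c K; first exact: (fillable_list x0 (ug c) (fun x => esym (Eg c x)) (AK c cK)).
  apply: (@fillable_list h k _ x0 [::]) (fillable0 h k) => // x; apply/negP => /andP[/gK].
  by move=> + /eqP E; rewrite E ltnNge cK.
have [t Ht] := nat_choice K AA.
(* Indices from [K] on belong to empty groups, for which the identity is a holed cover. *)
pose t' i := if i < K then t i else fun _ x => x.
have Ht' i : holed h k (fun x => P x && (g x == i)) (t' i).
  rewrite /t'; case: ltnP => Ki; first exact: Ht.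
  apply: holed_empty => x; apply/negP => /andP[/gK + /eqP E].
  by rewrite E ltnNge Ki.
have H := fillP F Ht'.
set l := flatten [seq grp c | c <- iota 0 K].
have -> : sumn [seq size (grp c) | c <- iota 0 K] = size l.
  by rewrite size_flatten /shape -map_comp.
apply: (list_fillable x0 _ _ H).
  rewrite /l; elim: {F gK AK t Ht t' Ht' H l} K => // K IH.
  rewrite -addn1 iotaD map_cat flatten_cat cat_uniq IH /= cats0 ug andbT /=.
  apply/hasPn => x; rewrite Eg => /andP[px /eqP gx]; apply/flatten_mapP => -[c].
  by rewrite mem_iota => /= cK; rewrite Eg gx => /andP[_ /eqP E]; rewrite E ltnn in cK.
move=> x; apply/idP/flatten_mapP => [px|[c _]]; last by rewrite Eg => /andP[].
by exists (g x); rewrite ?mem_iota ?gK // Eg px eqxx.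
Qed.

Definition has_td k m := exists (B : Type) (L : nat -> B -> nat) J, td k m L J.

(** Each point of weight [w] is replaced by [3 * w] copies, so group [c] of the resulting frame has
    three times the total weight of that group. These groups are then filled. *)
Lemma fillable_wfc h k K m (B : Type) (L : nat -> B -> nat) J wt t :
    td K m L J ->
    (forall b, frame (ptype (pattern K L wt b)) fst (t (pattern K L wt b))) ->
    (forall c, c < K -> fillable h k (3 * sumn [seq wt c x | x <- iota 0 m])) ->
  fillable h k (3 * sumn [seq sumn [seq wt c x | x <- iota 0 m] | c <- iota 0 K]).
Proof.
move=> T F AK.
have sumM (f : nat -> nat) s : sumn [seq 3 * f c | c <- s] = 3 * sumn [seq f c | c <- s].
  by elim: s => //= c s ->; rewrite mulnDr.
pose grp c := if c < K then [seq ((c, x), e) | x <- iota 0 m, e <- iota 0 (3 * wt c x)] else [::].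
have sz c : c < K -> size (grp c) = 3 * sumn [seq wt c x | x <- iota 0 m].
  move=> cK; rewrite /grp cK size_allpairs_dep -sumM.
  by congr (sumn _); apply: eq_map => x; rewrite size_iota.
rewrite -sumM; have -> : [seq 3 * sumn [seq wt c x | x <- iota 0 m] | c <- iota 0 K] =
    [seq size (grp c) | c <- iota 0 K].
  by apply/eq_in_map => c; rewrite mem_iota add0n => /= cK; rewrite sz.
apply: (fillable_frame ((0, 0), 0) (wfcP T F)).
- by move=> [[c x] e] /and3P[].
- move=> c; rewrite /grp; case: ifP => // _; apply: allpairs_uniq_dep.
  + exact: iota_uniq.
  + by move=> x _; exact: iota_uniq.
  + by move=> [x e] [x' e'] _ _ /= [-> ->].
- move=> c [[c' x] e]; rewrite /grp /wpt /=; case: ifP => cK; last first.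
    rewrite in_nil; apply/esym/negP => /andP[/and3P[c'K _ _] /eqP E].
    by rewrite E cK in c'K.
  apply/allpairsPdep/andP => [[x1 [e1 [ix ie E]]]|[/and3P[_ xm em] /eqP E]].
    by move: ix ie; rewrite !mem_iota /=; case: E => -> -> ->; rewrite cK => -> ->.
  by exists x, e; rewrite !mem_iota /= -E; split.
- by move=> c cK; rewrite sz //; exact: AK.
Qed.

(** * Existence of transversal designs *)

Lemma has_td_le k k' m : k' <= k -> has_td k m -> has_td k' m.
Proof.
move=> le [B [L [J [H1 H2 H3]]]]; exists B, L, J; split.
- by move=> c b ck; apply: H1; apply: leq_trans ck le.
- by move=> c x c' x' ck ck'; apply: H2; apply: leq_trans le.
- by move=> c c' b ck ck'; apply: H3; apply: leq_trans le.
Qed.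

Section TransversalDesigns.
Import GRing.Theory.

Section RingTd.
Local Open Scope ring_scope.
Variables (R : finComUnitRingType) (al : seq R).
Hypothesis alU : forall i j, (i < size al)%N -> (j < size al)%N -> i != j ->
  (al`_i - al`_j \is a GRing.unit).

Let k1 := size al.
(** The blocks are the lines [(a, s)]. A group [c < k1] records the value [a + al_c * s] and one
    further group records the slope [s]; [meet] recovers the line from two of these data. *)
Let line (c : nat) (b : R * R) : R := if (c < k1)%N then b.1 + al`_c * b.2 else b.2.
Let pt (x : nat) : R := nth 0 (enum R) x.
Let meet (c : nat) (x : R) (c' : nat) (x' : R) : R * R :=
  if (c < k1)%N then
    let s := if (c' < k1)%N then (x - x') / (al`_c - al`_c') else x' in
    (x - al`_c * s, s)
  else (x' - al`_c' * x, x).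

(** Two values of a line differ by [(al_c - al_c') * s]. The difference of the [al] is a unit, so
    the slope and then the intercept are determined. *)
Lemma ring_td : has_td k1.+1 #|R|.
Proof.
have ptK (z : R) : pt (index z (enum R)) = z by rewrite /pt nth_index ?mem_enum.
have ptK' x : (x < #|R|)%N -> index (pt x) (enum R) = x.
  by move=> xR; rewrite index_uniq ?enum_uniq -?cardE.
exists (R * R)%type, (fun c b => index (line c b) (enum R)),
  (fun c x c' x' => meet c (pt x) c' (pt x')); split.
- by move=> c b _; rewrite cardE index_mem mem_enum.
- move=> c x c' x' ck ck' ne xR xR'.
  suff [E1 E2] : line c (meet c (pt x) c' (pt x')) = pt x /\
      line c' (meet c (pt x) c' (pt x')) = pt x' by rewrite E1 E2 !ptK'.
  move: (pt x) (pt x') => X X'.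
  rewrite /meet /line; case c1: (c < k1)%N; case c1': (c' < k1)%N; rewrite /= ?subrK //; last by lia.
  have u := alU c1 c1' ne.
  split=> //; set s := _ / _; have es : s * (al`_c - al`_c') = X - X' by rewrite divrK.
  rewrite -addrA -mulNr -mulrDl mulrC.
  rewrite (_ : - al`_c + al`_c' = - (al`_c - al`_c')); last by rewrite opprB addrC.
  by rewrite mulrN es opprB addrC subrK.
- move=> c c' [a s] ck ck' ne; rewrite !ptK /meet /line.
  case c1: (c < k1)%N; case c1': (c' < k1)%N; rewrite /= ?addrK //; last by lia.
  have u := alU c1 c1' ne.
  have -> : (a + al`_c * s - (a + al`_c' * s)) / (al`_c - al`_c') = s.
    rewrite opprD addrACA subrr add0r -mulrBl mulrC mulKr //.
  by rewrite addrK.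
Qed.
End RingTd.

(** The elements 0, ..., 4 differ by at most 4 in absolute value, and 1, 2, 3, 4 are units modulo a
    number prime to 6. The slope supplies the sixth group. *)
Lemma has_td_coprime6 m : coprime m 6 -> 1 < m -> has_td 6 m.
Proof.
rewrite (coprimeMr m 2 3) => /andP[co2 co3] m1.
pose al := [seq (i%:R : 'Z_m)%R | i <- iota 0 5].
have := @ring_td 'Z_m al; rewrite card_ord Zp_cast //; apply.
have u (d : nat) : 0 < d < 5 -> (d%:R : 'Z_m)%R \is a GRing.unit.
  rewrite unitZpE //.
  case: d => [|[|[|[|[|//]]]]] // _; first exact: coprimen1.
  by rewrite (coprimeMr m 2 2) co2.
move=> i j; rewrite size_map size_iota => i5 j5 ne.
rewrite !(nth_map 0) ?size_iota // !nth_iota // !add0n.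
have [ij|/ltnW ij] := leqP j i.
  by rewrite -natrB // u //; lia.
rewrite -opprB unitrN -natrB // u //; lia.
Qed.

Lemma has_td_field (F : finFieldType) k : k <= #|F| -> has_td k.+1 #|F|.
Proof.
move=> kF; pose al := take k (enum F).
have sz : size al = k by rewrite size_take -cardE; case: ltngtP kF.
rewrite -{1}sz; apply: ring_td => i j; rewrite sz => ik jk ne.
have lt a : a < k -> a < size (enum F) by move=> ak; rewrite -cardE; exact: leq_trans ak kF.
by rewrite unitfE subr_eq0 !nth_take // nth_uniq ?enum_uniq ?lt.
Qed.

Lemma has_td_primepower k p e : prime p -> 0 < e -> k <= p ^ e -> has_td k.+1 (p ^ e).
Proof.
move=> pr e0 kp; have [F _ cF] := PrimePowerField pr e0.
by rewrite -cF; apply: has_td_field; rewrite cF.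
Qed.
End TransversalDesigns.

(** * Checking covers by computation *)

Section Check.
Variable T : eqType.

Definition permutes (f : T -> T) (l : seq T) :=
  all (fun x => f x \in l) l && uniq (map f l).
Definition generates (f : T -> T) (r l : seq T) :=
  all (mem l) r && all (fun x => has (fun z => x \in traject f z (size l)) r) l.

Variables (pts cls : seq T) (fx U M : rel T) (s : T -> T -> T).
Variables (pi sg : T -> T) (rp rc : seq T).

(* [pi] on points and [sg] on classes are automorphisms, so that most conditions need only be
   verified for representatives [rp], [rc] of their orbits. *)
Definition odc_check :=
  [&& uniq cls, permutes pi pts && permutes sg cls,
      generates pi rp pts && generates sg rc cls,
      all (fun y => all (fun x => (s (sg y) (pi x) == pi (s y x)) &&
        (fx (sg y) (pi x) == fx y x)) pts) cls,
      all (fun x => all (fun x' => U (pi x) (pi x') == U x x') pts) pts &&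
      all (fun y => all (fun y' => M (sg y) (sg y') == M y y') cls) cls,
      all (fun y => all (fun x => [&& s y x \in pts, s y (s y (s y x)) == x &
        (s y x == x) == fx y x]) pts) rc,
      all (fun x => let col := [seq (s y x, s y (s y x)) | y <- cls] in
        all (fun x' => if x' == x then ~~ U x x' else
          count (fun ab => (ab.1 == x') || (ab.2 == x')) col == if U x x' then 2 else 0) pts) rp &
      all (fun y => let row := [seq (x, s y x) | x <- pts] in
        all (fun y' => M y y' ==> has (fun p => (p.1 != p.2) &&
          ((s y' p.1 == p.2) || (s y' p.2 == p.1))) row) cls) rc].

(** An injection of a finite list into itself is onto, by comparing sizes. *)
Lemma permutesP f l : permutes f l ->
  [/\ forall x, x \in l -> f x \in l, {in l &, injective f} &
      forall z, z \in l -> exists2 x, x \in l & z = f x].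
Proof.
move=> /andP[/allP fl ul].
have ml : map f l =i l.
  apply: (uniq_min_size ul _ _).2; last by rewrite size_map.
  by move=> z /mapP[x lx ->]; apply: fl.
split=> //; last by move=> z; rewrite -ml => /mapP.
move=> x z lx lz E; apply/eqP; move: E => /eqP.
rewrite -{1}(nth_index x lx) -{1}(nth_index x lz).
rewrite -!(nth_map x (f x)) ?index_mem // nth_uniq ?size_map ?index_mem //.
by move=> /eqP E; apply/eqP; rewrite -(nth_index x lx) E nth_index.
Qed.

(** Induction along orbits: a property holding at the representatives and passing from [x] to [f x]
    holds on the whole list. *)
Lemma generatesP f r l (Q : T -> Prop) : generates f r l ->
    (forall x, x \in l -> f x \in l) ->
    (forall x, x \in r -> Q x) -> (forall x, x \in l -> Q x -> Q (f x)) ->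
  forall x, x \in l -> Q x.
Proof.
move=> /andP[/allP rl /allP gen] fl Qr Qf x /gen /hasP[z rz /trajectP[i _ ->]].
suff: iter i f z \in l /\ Q (iter i f z) by case.
by elim: i => /= [|i [li Qi]]; split; auto; exact: rl.
Qed.

Lemma count2P (p : pred T) (l : seq T) : uniq l -> count p l = 2 ->
  exists y1 y2, [/\ y1 \in l, y2 \in l, y1 != y2 &
    forall y, y \in l -> p y = (y == y1) || (y == y2)].
Proof.
move=> ul; rewrite -size_filter => sz; have uf := filter_uniq p ul.
have mf y : y \in l -> p y = (y \in filter p l) by move=> ly; rewrite mem_filter ly andbT.
have sub y : y \in filter p l -> y \in l by rewrite mem_filter => /andP[].
case: (filter p l) sz uf mf sub => [|y1 [|y2 [|]]] //= _ /andP[n12 _] mf sub.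
exists y1, y2; split; try by apply: sub; rewrite !inE eqxx ?orbT.
  by move: n12; rewrite inE.
by move=> y /mf->; rewrite !inE.
Qed.

(** The pair [pi], [sg] commutes with the rotations and preserves [fx], [U] and [M]. Each remaining
    condition is hence invariant and spreads from the representatives over their orbits. *)
Lemma odc_checkP : odc_check ->
  odc (fun x => x \in pts) (fun y => y \in cls) fx U M s.
Proof.
case/and5P=> ucls /andP[/permutesP[pi_in pi_inj pi_sur] /permutesP[sg_in sg_inj sg_sur]].
move=> /andP[gp gc] /allP eqv /and4P[/andP[/allP Uinv /allP Minv] /allP rows /allP two /allP meets].
have eqs y x : y \in cls -> x \in pts -> s (sg y) (pi x) = pi (s y x).
  by move=> cy px; have /allP/(_ x px)/andP[/eqP] := eqv y cy.
have eqf y x : y \in cls -> x \in pts -> fx (sg y) (pi x) = fx y x.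
  by move=> cy px; have /allP/(_ x px)/andP[_ /eqP] := eqv y cy.
have eqU x x' : x \in pts -> x' \in pts -> U (pi x) (pi x') = U x x'.
  by move=> px px'; have /allP/(_ x' px')/eqP := Uinv x px.
have eqM y y' : y \in cls -> y' \in cls -> M (sg y) (sg y') = M y y'.
  by move=> cy cy'; have /allP/(_ y' cy')/eqP := Minv y cy.
have pi_eq x x' : x \in pts -> x' \in pts -> (pi x == pi x') = (x == x').
  by move=> px px'; apply/eqP/eqP => [/pi_inj->|->].
have row y : y \in cls -> forall x, x \in pts ->
    [/\ s y x \in pts, s y (s y (s y x)) = x & (s y x == x) = fx y x].
  move: y; apply: (generatesP gc sg_in) => [y ry x px|y cy IH x px].
    by have /allP/(_ x px)/and3P[? /eqP ? /eqP] := rows y ry.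
  have [z pz ->] := pi_sur x px; have [p1 E3 E1] := IH z pz; have [p2 _ _] := IH _ p1.
  by rewrite !eqs // eqf // pi_eq // E3 E1; split=> //; exact: pi_in.
have s_in y x cy px := let: And3 h _ _ := row y cy x px in h.
have s_cub y x cy px := let: And3 _ h _ := row y cy x px in h.
(* Under a map of order three the predecessor of a point is its second iterate; the check tests
   coverage in this form. *)
have covE y x x' : y \in cls -> x \in pts -> x' \in pts ->
    cov (s y) x x' = (s y x == x') || (s y (s y x) == x').
  move=> cy px px'; congr (_ || _).
  by apply/eqP/eqP => [<-|<-]; rewrite s_cub.
have covpi y x x' : y \in cls -> x \in pts -> x' \in pts ->
    cov (s (sg y)) (pi x) (pi x') = cov (s y) x x'.
  by move=> cy px px'; rewrite /cov !eqs // !pi_eq // s_in.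
(* Because [sg] only permutes the classes, the number of classes covering a pair is the same for the
   pair and its image under [pi]. *)
have permsg : perm_eq (map sg cls) cls.
  apply: uniq_perm => //.
    by rewrite map_inj_in_uniq.
  move=> z; apply/mapP/idP => [[y cy ->]|/sg_sur[y cy ->]]; first exact: sg_in.
  by exists y.
have cnt x : x \in pts -> forall x', x' \in pts -> x' != x ->
    count (fun y => cov (s y) x x') cls = if U x x' then 2 else 0.
  move: x; apply: (generatesP gp pi_in) => [x rx x' px' ne|x px IH x' px' ne].
    have px : x \in pts by have /andP[/allP h _] := gp; exact: h.
    have /allP/(_ x' px') := two x rx; rewrite (negPf ne) count_map => /eqP<-.
    by apply: eq_in_count => y cy; rewrite covE.
  have [z pz E] := pi_sur x' px'; rewrite E in ne *.
  rewrite eqU // -IH //; last by apply: contra ne => /eqP->.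
  rewrite -(permP permsg) count_map; apply: eq_in_count => y cy /=.
  by rewrite covpi.
have Uirr x : x \in pts -> ~~ U x x.
  move: x; apply: (generatesP gp pi_in) => [x rx|x px]; last by rewrite eqU.
  have px : x \in pts by have /andP[/allP h _] := gp; exact: h.
  by have /allP/(_ x px) := two x rx; rewrite eqxx.
have has_meet y : y \in cls -> forall y', y' \in cls -> M y y' ->
    exists x x', [/\ x \in pts, x' \in pts, x != x', cov (s y) x x' & cov (s y') x x'].
  move: y; apply: (generatesP gc sg_in) => [y ry y' cy' m|y cy IH y' cy'].
    have cy : y \in cls by have /andP[/allP h _] := gc; exact: h.
    have /allP/(_ y' cy')/implyP/(_ m)/hasP[p /mapP[x px ->] /=] := meets y ry.
    move=> /andP[ne c]; exists x, (s y x); split=> //; first exact: s_in.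
    by rewrite /cov eqxx.
  have [w cw ->] := sg_sur y' cy'; rewrite eqM // => /(IH _ cw)[x [x' [px px' ne c c']]].
  by exists (pi x), (pi x'); rewrite !covpi // pi_eq // !pi_in.
split=> //.
- by move=> y x cy px; have [] := row y cy x px.
- move=> x x' px px' u; have [E|ne] := eqVneq x' x; last by apply: count2P => //; rewrite cnt // u.
  by rewrite E (negPf (Uirr x px)) in u.
- move=> y x x' cy px px' ne nu; have := cnt x px x' px'; rewrite eq_sym ne (negPf nu) => /(_ isT)/eqP.
  by rewrite eqn0Ngt -has_count => /hasPn/(_ y cy).
- by move=> y y' cy cy' m; apply: has_meet.
Qed.
End Check.

(** * Covers given by base classes and rotations, on binary numbers for fast evaluation *)

Notation bN := BinNums.N.
Notation "x +b y" := (BinNat.N.add x y) (at level 50, left associativity).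
Notation "x -b y" := (BinNat.N.sub x y) (at level 50, left associativity).
Notation "x <b y" := (BinNat.N.ltb x y) (at level 70).

(* The points 0, 1, ... are cut into consecutive cycles, of the lengths listed in [L], on which an
   automorphism acts by rotation; the classes likewise, with lengths [LC]. The table [T] holds for
   each cycle of classes its first member, as the concatenation of its triples; the other members
   are its images, computed by [develop]. *)
Fixpoint cycle_of (b : bN) (L : seq bN) (x : bN) : bN * bN :=
  if L is l :: L' then if x <b (b +b l) then (b, l) else cycle_of (b +b l) L' x
  else (b, 1%bn).
Definition turn (L : seq bN) (t x : bN) : bN :=
  let (b, l) := cycle_of 0%bn L x in b +b BinNat.N.modulo ((x -b b) +b t) l.
Definition unturn (L : seq bN) (t x : bN) : bN :=
  let (b, l) := cycle_of 0%bn L x in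
  b +b BinNat.N.modulo ((x -b b) +b (l -b BinNat.N.modulo t l)) l.

Fixpoint starts (b : bN) (L : seq bN) : seq bN :=
  if L is l :: L' then b :: starts (b +b l) L' else [::].

(** Points in none of the listed triples stay fixed, which is how a class misses them. *)
Fixpoint next_in (D : seq bN) (x : bN) : bN :=
  if D is a :: b :: c :: D' then
    if x == a then b else if x == b then c else if x == c then a else next_in D' x
  else x.

Fixpoint base_class (b : bN) (LC : seq bN) (T : seq (seq bN)) (y : bN) : seq bN * bN :=
  match LC, T with
  | l :: LC', D :: T' => if y <b (b +b l) then (D, y -b b) else base_class (b +b l) LC' T' y
  | _, _ => ([::], 0%bn)
  end.

(** A base class in a short cycle must return to itself after one turn of that cycle. This is not
    built in here; the equivariance test of [odc_check] detects any failure. *)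
Definition develop (L LC : seq bN) (T : seq (seq bN)) (y x : bN) : bN :=
  let (D, t) := base_class 0%bn LC T y in turn L t (next_in D (unturn L t x)).

Definition codes (v : nat) : seq bN := [seq bin_of_nat i | i <- iota 0 v].

Definition developed_check (L LC : seq bN) (fx U M : rel bN) (T : seq (seq bN)) :=
  let v := sumn [seq nat_of_bin l | l <- L] in let w := sumn [seq nat_of_bin l | l <- LC] in
  odc_check (codes v) (codes w) fx U M (develop L LC T)
    (turn L 1%bn) (turn LC 1%bn) (starts 0%bn L) (starts 0%bn LC).

(** Hole points and the classes missing the hole are fixed by the automorphism: they form cycles of
    length one, numbered after the ordinary ones. *)
Definition holed_check (h k : nat) (L : seq bN) (T : seq (seq bN)) :=
  let g := bin_of_nat (sumn [seq nat_of_bin l | l <- L]) in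
  let both x y := ~~ (x <b g) && ~~ (y <b g) in
  developed_check (L ++ nseq h 1%bn) (L ++ nseq k 1%bn) both
    (fun x x' => (x != x') && ~~ both x x') (fun y y' => (y != y') && ~~ both y y') T.

Definition frame_check (g : bN -> nat) (L : seq bN) (T : seq (seq bN)) :=
  let r x x' := g x != g x' in
  developed_check L L (fun y x => g y == g x) r r T.

Lemma mem_codes v x : (x \in codes v) = (nat_of_bin x < v).
Proof.
rewrite -[x in LHS]nat_of_binK mem_map ?mem_iota //; exact: (can_inj bin_of_natK).
Qed.

Lemma ltbE x y : (x <b y) = (nat_of_bin x < nat_of_bin y).
Proof.
apply/idP/idP => [/BinNat.N.ltb_lt|lt]; first by lia.
by apply/BinNat.N.ltb_lt; lia.
Qed.

Lemma sumn_ones (L : seq bN) h :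
  sumn [seq nat_of_bin l | l <- L ++ nseq h 1%bn] = sumn [seq nat_of_bin l | l <- L] + h.
Proof. by rewrite map_cat sumn_cat map_nseq sumn_nseq mul1n. Qed.

Lemma holed_checkP h k L T :
  holed_check h k L T -> fillable h k (sumn [seq nat_of_bin l | l <- L]).
Proof.
set g := sumn _ => /odc_checkP; rewrite !sumn_ones -/g => H.
pose dec (x : bN) : nat + nat := if nat_of_bin x < g then inl (nat_of_bin x) else inr (nat_of_bin x - g).
pose enc (z : nat + nat) := match z with inl x => bin_of_nat x | inr i => bin_of_nat (g + i) end.
have decK n x : x \in codes (g + n) -> ext n (fun x => x < g) (dec x) /\ enc (dec x) = x.
  rewrite mem_codes /dec; case: (ltnP (nat_of_bin x) g) => gx xn /=; first by rewrite gx nat_of_binK.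
  by rewrite subnKC // nat_of_binK; split=> //; lia.
have encK n z : ext n (fun x => x < g) z -> enc z \in codes (g + n) /\ dec (enc z) = z.
  rewrite mem_codes /dec; case: z => /= x hx; rewrite bin_of_natK.
    by rewrite hx; split=> //; lia.
  by rewrite ltn_add2l hx ltnNge leq_addr /= addKn.
have encr n z : ext n (fun x => x < g) z -> ~~ (enc z <b bin_of_nat g) = isr z.
  rewrite ltbE !bin_of_natK; case: z => /= x hx; rewrite bin_of_natK; first by rewrite hx.
  by rewrite -leqNgt leq_addr.
have encI n n' z z' : ext n (fun x => x < g) z -> ext n' (fun x => x < g) z' ->
    (enc z == enc z') = (z == z').
  move=> hz hz'; apply/eqP/eqP => [E|-> //].
  by have [_ <-] := encK _ _ hz; rewrite E; have [_ ->] := encK _ _ hz'.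
eexists; apply: (odc_transport (f := dec) (f' := enc) (h := dec) (h' := enc) _ _ _ _ _ _ _ H).
- exact: decK.
- exact: encK.
- exact: decK.
- exact: encK.
- by move=> w z hw hz; rewrite (encr k) ?(encr h).
- by move=> z z' hz hz'; rewrite !(encr h) // (encI h h).
- by move=> z z' hz hz'; rewrite !(encr k) // (encI k k).
Qed.

Lemma frame_checkP g L T : frame_check g L T ->
  frame (fun x => x \in codes (sumn [seq nat_of_bin l | l <- L])) g (develop L L T).
Proof. exact: odc_checkP. Qed.

Definition group_list (g : bN -> nat) (v c : nat) := [seq x <- codes v | g x == c].

Lemma codes_uniq v : uniq (codes v).
Proof. by rewrite map_inj_uniq ?iota_uniq //; exact: (can_inj bin_of_natK). Qed.

Definition groups_check (g : bN -> nat) (v : nat) (w : seq nat) :=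
  all (fun x => g x < size w) (codes v) &&
  (w == [seq count (fun x => g x == c) (codes v) | c <- iota 0 (size w)]).

Lemma groups_checkP g v w : groups_check g v w ->
  (forall x, x \in codes v -> g x < size w) /\
  (forall c, c < size w -> size (group_list g v c) = nth 0 w c).
Proof.
move=> /andP[/allP gw /eqP Ew]; split=> // c cw.
by rewrite {1}Ew (nth_map 0) ?size_iota // nth_iota // size_filter.
Qed.

Lemma fillable_frame_check h k g L T w :
    frame_check g L T -> groups_check g (sumn [seq nat_of_bin l | l <- L]) w ->
    (forall n, n \in w -> fillable h k n) ->
  fillable h k (sumn w).
Proof.
move=> /frame_checkP; set v := sumn _ => F /groups_checkP[gw sz] Hw.
have -> : w = [seq size (group_list g v c) | c <- iota 0 (size w)].
  apply: (@eq_from_nth _ 0) => [|c cw]; first by rewrite size_map size_iota.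
  by rewrite (nth_map 0) ?size_iota // nth_iota // sz.
apply: (fillable_frame 0%bn F) => //.
- by move=> c; rewrite filter_uniq ?codes_uniq.
- by move=> c x; rewrite mem_filter andbC.
- by move=> c cw; rewrite sz //; apply: Hw; exact: mem_nth.
Qed.

Lemma ptype_frame_check g L T w :
    frame_check g L T ->
    groups_check g (sumn [seq nat_of_bin l | l <- L]) [seq 3 * n | n <- w] ->
  exists s, frame (ptype w) fst s.
Proof.
move=> /frame_checkP; set v := sumn _ => F /groups_checkP[gw sz].
rewrite size_map in gw sz.
(* A code is renumbered by its group and its rank among the codes of that group. *)
pose enc (p : nat * nat) := nth 0%bn (group_list g v p.1) p.2.
pose dec x := (g x, index x (group_list g v (g x))).
have szc c : c < size w -> size (group_list g v c) = 3 * nth 0 w c.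
  by move=> cw; rewrite sz // (nth_map 0).
have decK x : x \in codes v -> ptype w (dec x) /\ enc (dec x) = x.
  move=> px; have mx : x \in group_list g v (g x) by rewrite mem_filter eqxx.
  by rewrite /ptype /= gw // -szc ?gw // index_mem mx /enc nth_index.
have encK p : ptype w p -> enc p \in codes v /\ dec (enc p) = p.
  case: p => c e /andP[/= cw]; rewrite -szc // => ec; rewrite /enc /dec /=.
  have := mem_nth 0%bn ec; rewrite mem_filter => /andP[/eqP-> ->].
  by rewrite index_uniq ?filter_uniq ?codes_uniq.
have ge p : ptype w p -> g (enc p) = p.1.
  by move=> /encK[_ E]; rewrite -{2}E.
eexists; apply: (odc_transport (f := dec) (f' := enc) (h := dec) (h' := enc) _ _ _ _ _ _ _ F) => //.
- by move=> p q hp hq; rewrite !ge.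
- by move=> p q hp hq; rewrite !ge.
- by move=> p q hp hq; rewrite !ge.
Qed.

(** * Small covers and frames *)

(** In [base4] to [base30] the three largest numbers are the hole points. The last two lists are the
    classes missing the hole, each invariant under the rotation; the others generate the ordinary
    classes. *)
Definition base4 : seq (seq bN) := [::
  [:: 2; 6; 12; 3; 10; 13; 0; 5; 14; 8; 9; 11; 1; 4; 7];
  [:: 2; 4; 11; 1; 9; 12; 5; 7; 13; 3; 6; 8; 0; 10; 14];
  [:: 3; 10; 13; 5; 6; 8; 0; 1; 2; 4; 9; 14; 7; 11; 12];
  [:: 0; 4; 8; 1; 5; 9; 2; 6; 10; 3; 7; 11];
  [:: 0; 5; 10; 1; 6; 11; 2; 7; 8; 3; 4; 9]]%bn.
Lemma fillable_4 : fillable 3 2 (3 * 4).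
Proof. by apply: (@holed_checkP 3 2 [:: 4; 4; 4]%bn base4); vm_compute. Qed.

Definition base5 : seq (seq bN) := [::
  [:: 5; 11; 16; 0; 8; 9; 3; 7; 14; 6; 13; 17; 2; 4; 12; 1; 10; 15];
  [:: 4; 9; 12; 7; 11; 17; 2; 3; 5; 10; 13; 14; 0; 6; 15; 1; 8; 16];
  [:: 3; 4; 17; 0; 2; 11; 5; 14; 15; 1; 13; 16; 6; 8; 9; 7; 10; 12];
  [:: 0; 5; 10; 1; 6; 11; 2; 7; 12; 3; 8; 13; 4; 9; 14];
  [:: 0; 6; 12; 1; 7; 13; 2; 8; 14; 3; 9; 10; 4; 5; 11]]%bn.
Lemma fillable_5 : fillable 3 2 (3 * 5).
Proof. by apply: (@holed_checkP 3 2 [:: 5; 5; 5]%bn base5); vm_compute. Qed.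

Definition base6 : seq (seq bN) := [::
  [:: 9; 17; 18; 10; 14; 19; 5; 6; 20; 4; 7; 13; 0; 1; 2; 8; 12; 15; 3; 11; 16];
  [:: 15; 5; 18; 16; 2; 19; 11; 12; 20; 10; 13; 1; 6; 7; 8; 14; 0; 3; 9; 17; 4];
  [:: 3; 11; 18; 4; 8; 19; 17; 0; 20; 16; 1; 7; 12; 13; 14; 2; 6; 9; 15; 5; 10];
  [:: 0; 2; 4; 1; 3; 5; 6; 8; 10; 7; 9; 11; 12; 14; 16; 13; 15; 17];
  [:: 0; 6; 12; 1; 7; 13; 2; 8; 14; 3; 9; 15; 4; 10; 16; 5; 11; 17]]%bn.
Lemma fillable_6 : fillable 3 2 (3 * 6).
Proof. by apply: (@holed_checkP 3 2 [:: 6; 6; 6]%bn base6); vm_compute. Qed.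

Definition base7 : seq (seq bN) := [::
  [:: 3; 21; 12; 0; 18; 9; 10; 4; 5; 19; 17; 15; 16; 8; 22; 1; 6; 11; 14; 20; 7; 23; 13; 2];
  [:: 13; 21; 17; 7; 1; 18; 20; 8; 10; 3; 6; 2; 4; 16; 22; 9; 12; 15; 0; 5; 14; 23; 19; 11];
  [:: 19; 21; 6; 14; 9; 1; 5; 16; 20; 13; 12; 11; 8; 4; 22; 18; 17; 2; 7; 10; 0; 23; 3; 15];
  [:: 0; 7; 14; 1; 8; 15; 2; 9; 16; 3; 10; 17; 4; 11; 18; 5; 12; 19; 6; 13; 20];
  [:: 0; 8; 17; 1; 9; 18; 2; 10; 19; 3; 11; 20; 4; 12; 14; 5; 13; 15; 6; 7; 16]]%bn.
Lemma fillable_7 : fillable 3 2 (3 * 7).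
Proof. by apply: (@holed_checkP 3 2 [:: 7; 7; 7]%bn base7); vm_compute. Qed.

Definition base8 : seq (seq bN) := [::
  [:: 10; 8; 20; 7; 5; 26; 6; 16; 11; 2; 18; 19; 3; 9; 4; 0; 17; 24; 22; 23; 25; 1; 13; 14; 12;
    15; 21];
  [:: 2; 20; 16; 5; 21; 26; 12; 8; 23; 18; 10; 1; 9; 15; 14; 6; 19; 24; 4; 13; 25; 17; 11; 22; 0;
    3; 7];
  [:: 18; 16; 8; 21; 7; 26; 0; 20; 13; 10; 2; 17; 15; 3; 22; 12; 1; 24; 14; 11; 25; 19; 23; 4; 6;
    9; 5];
  [:: 12; 2; 4; 15; 17; 26; 20; 0; 5; 14; 16; 7; 21; 23; 6; 18; 11; 24; 10; 1; 25; 9; 3; 8; 22;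
    19; 13];
  [:: 0; 4; 2; 1; 5; 3; 6; 14; 18; 7; 15; 19; 8; 16; 20; 9; 17; 21; 10; 12; 22; 11; 13; 23];
  [:: 0; 16; 18; 1; 17; 19; 2; 12; 20; 3; 13; 21; 4; 14; 22; 5; 15; 23; 6; 10; 8; 7; 11; 9]]%bn.
Lemma fillable_8 : fillable 3 2 (3 * 8).
Proof. by apply: (@holed_checkP 3 2 [:: 6; 6; 6; 6]%bn base8); vm_compute. Qed.

Definition base9 : seq (seq bN) := [::
  [:: 5; 22; 29; 1; 2; 7; 13; 14; 24; 3; 11; 25; 6; 12; 21; 9; 16; 20; 8; 19; 23; 10; 26; 27; 4;
    18; 28; 0; 15; 17];
  [:: 14; 4; 29; 10; 11; 16; 22; 23; 6; 12; 20; 7; 15; 21; 3; 18; 25; 2; 17; 1; 5; 19; 8; 27; 13;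
    0; 28; 9; 24; 26];
  [:: 23; 13; 29; 19; 20; 25; 4; 5; 15; 21; 2; 16; 24; 3; 12; 0; 7; 11; 26; 10; 14; 1; 17; 27;
    22; 9; 28; 18; 6; 8];
  [:: 0; 9; 18; 1; 10; 19; 2; 11; 20; 3; 12; 21; 4; 13; 22; 5; 14; 23; 6; 15; 24; 7; 16; 25; 8;
    17; 26];
  [:: 0; 3; 6; 1; 4; 7; 2; 5; 8; 9; 12; 15; 10; 13; 16; 11; 14; 17; 18; 21; 24; 19; 22; 25; 20;
    23; 26]]%bn.
Lemma fillable_9 : fillable 3 2 (3 * 9).
Proof. by apply: (@holed_checkP 3 2 [:: 9; 9; 9]%bn base9); vm_compute. Qed.

Definition base10 : seq (seq bN) := [::
  [:: 18; 25; 30; 14; 23; 31; 19; 8; 27; 9; 16; 21; 2; 11; 29; 1; 17; 22; 6; 26; 24; 10; 7; 12;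
    13; 3; 15; 4; 20; 28; 0; 5; 32];
  [:: 21; 20; 24; 2; 27; 30; 1; 9; 28; 18; 5; 8; 7; 0; 12; 16; 22; 19; 6; 29; 31; 17; 23; 11; 3;
    4; 25; 26; 13; 14; 10; 15; 32];
  [:: 6; 2; 22; 19; 29; 23; 21; 10; 24; 8; 9; 15; 14; 17; 18; 3; 12; 1; 5; 13; 30; 7; 11; 31; 27;
    16; 26; 4; 0; 28; 20; 25; 32];
  [:: 0; 18; 25; 1; 19; 26; 2; 10; 27; 3; 11; 28; 4; 12; 29; 5; 13; 20; 6; 14; 21; 7; 15; 22; 8;
    16; 23; 9; 17; 24];
  [:: 0; 14; 23; 1; 15; 24; 2; 16; 25; 3; 17; 26; 4; 18; 27; 5; 19; 28; 6; 10; 29; 7; 11; 20; 8;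
    12; 21; 9; 13; 22]]%bn.
Lemma fillable_10 : fillable 3 2 (3 * 10).
Proof. by apply: (@holed_checkP 3 2 [:: 10; 10; 10]%bn base10); vm_compute. Qed.

Definition base12 : seq (seq bN) := [::
  [:: 16; 26; 36; 13; 32; 37; 20; 11; 22; 4; 35; 28; 21; 1; 23; 15; 29; 33; 9; 34; 7; 25; 10; 3;
    2; 27; 5; 8; 31; 24; 30; 14; 19; 6; 12; 18; 0; 17; 38];
  [:: 22; 1; 2; 3; 4; 14; 5; 35; 19; 21; 20; 29; 8; 34; 36; 23; 15; 32; 10; 28; 17; 9; 26; 30;
    13; 16; 33; 11; 31; 37; 24; 27; 25; 0; 6; 18; 12; 7; 38];
  [:: 1; 5; 29; 16; 15; 19; 4; 17; 37; 18; 3; 32; 11; 9; 2; 6; 20; 13; 22; 7; 28; 8; 0; 31; 21;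
    33; 34; 10; 14; 36; 23; 35; 26; 12; 27; 25; 24; 30; 38];
  [:: 0; 16; 26; 1; 17; 27; 2; 18; 28; 3; 19; 29; 4; 20; 30; 5; 21; 31; 6; 22; 32; 7; 23; 33; 8;
    12; 34; 9; 13; 35; 10; 14; 24; 11; 15; 25];
  [:: 0; 13; 32; 1; 14; 33; 2; 15; 34; 3; 16; 35; 4; 17; 24; 5; 18; 25; 6; 19; 26; 7; 20; 27; 8;
    21; 28; 9; 22; 29; 10; 23; 30; 11; 12; 31]]%bn.
Lemma fillable_12 : fillable 3 2 (3 * 12).
Proof. by apply: (@holed_checkP 3 2 [:: 12; 12; 12]%bn base12); vm_compute. Qed.

Definition base14 : seq (seq bN) := [::
  [:: 18; 34; 42; 25; 33; 43; 35; 16; 4; 40; 8; 3; 17; 12; 27; 19; 2; 15; 28; 24; 38; 32; 9; 6;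
    31; 26; 10; 22; 13; 20; 14; 41; 29; 30; 36; 39; 37; 5; 11; 23; 1; 21; 0; 7; 44];
  [:: 31; 19; 20; 18; 13; 1; 3; 36; 43; 6; 5; 26; 35; 34; 25; 16; 8; 7; 17; 38; 37; 4; 32; 28;
    10; 30; 42; 39; 22; 27; 40; 23; 15; 41; 0; 29; 33; 2; 12; 9; 11; 24; 14; 21; 44];
  [:: 3; 33; 39; 10; 5; 2; 6; 36; 31; 0; 24; 38; 23; 11; 7; 8; 26; 42; 9; 20; 43; 4; 32; 14; 12;
    34; 37; 27; 40; 13; 21; 41; 18; 22; 29; 19; 15; 1; 30; 25; 16; 17; 28; 35; 44];
  [:: 0; 18; 34; 1; 19; 35; 2; 20; 36; 3; 21; 37; 4; 22; 38; 5; 23; 39; 6; 24; 40; 7; 25; 41; 8;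
    26; 28; 9; 27; 29; 10; 14; 30; 11; 15; 31; 12; 16; 32; 13; 17; 33];
  [:: 0; 25; 33; 1; 26; 34; 2; 27; 35; 3; 14; 36; 4; 15; 37; 5; 16; 38; 6; 17; 39; 7; 18; 40; 8;
    19; 41; 9; 20; 28; 10; 21; 29; 11; 22; 30; 12; 23; 31; 13; 24; 32]]%bn.
Lemma fillable_14 : fillable 3 2 (3 * 14).
Proof. by apply: (@holed_checkP 3 2 [:: 14; 14; 14]%bn base14); vm_compute. Qed.

Definition base16 : seq (seq bN) := [::
  [:: 26; 47; 48; 29; 45; 49; 9; 23; 3; 11; 43; 15; 22; 46; 42; 12; 44; 1; 7; 30; 10; 37; 19; 36;
    34; 40; 31; 32; 5; 4; 14; 25; 39; 6; 13; 20; 33; 21; 18; 27; 41; 2; 35; 38; 28; 8; 16; 24; 0;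
    17; 50];
  [:: 10; 40; 36; 30; 21; 20; 3; 32; 49; 18; 23; 22; 39; 42; 4; 5; 46; 7; 6; 37; 48; 34; 33; 13;
    38; 45; 43; 11; 44; 29; 2; 9; 12; 35; 41; 1; 25; 27; 31; 14; 47; 19; 26; 28; 17; 0; 8; 24;
    16; 15; 50];
  [:: 1; 27; 48; 26; 39; 37; 42; 23; 8; 3; 16; 49; 30; 47; 11; 33; 31; 12; 7; 18; 9; 38; 29; 14;
    24; 2; 44; 45; 22; 10; 41; 19; 46; 0; 5; 4; 43; 21; 34; 35; 25; 13; 28; 6; 36; 15; 20; 17;
    32; 40; 50];
  [:: 0; 26; 47; 1; 27; 32; 2; 28; 33; 3; 29; 34; 4; 30; 35; 5; 31; 36; 6; 16; 37; 7; 17; 38; 8;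
    18; 39; 9; 19; 40; 10; 20; 41; 11; 21; 42; 12; 22; 43; 13; 23; 44; 14; 24; 45; 15; 25; 46];
  [:: 0; 29; 45; 1; 30; 46; 2; 31; 47; 3; 16; 32; 4; 17; 33; 5; 18; 34; 6; 19; 35; 7; 20; 36; 8;
    21; 37; 9; 22; 38; 10; 23; 39; 11; 24; 40; 12; 25; 41; 13; 26; 42; 14; 27; 43; 15; 28;
    44]]%bn.
Lemma fillable_16 : fillable 3 2 (3 * 16).
Proof. by apply: (@holed_checkP 3 2 [:: 16; 16; 16]%bn base16); vm_compute. Qed.

Definition base17 : seq (seq bN) := [::
  [:: 23; 33; 34; 20; 32; 35; 19; 52; 36; 21; 25; 37; 11; 24; 38; 31; 51; 39; 27; 18; 40; 8; 15;
    41; 12; 13; 42; 10; 2; 43; 6; 30; 44; 14; 26; 45; 16; 4; 46; 1; 5; 47; 3; 29; 48; 22; 28; 49;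
    7; 9; 50; 0; 17; 53];
  [:: 15; 52; 34; 1; 24; 35; 5; 8; 36; 2; 22; 37; 6; 28; 38; 16; 26; 39; 31; 33; 40; 32; 18; 41;
    3; 51; 42; 19; 20; 43; 12; 23; 44; 11; 27; 45; 9; 30; 46; 7; 25; 47; 4; 10; 48; 14; 29; 49;
    13; 21; 50; 0; 17; 53];
  [:: 7; 13; 20; 11; 21; 29; 14; 18; 22; 16; 19; 31; 15; 17; 52; 4; 5; 9; 1; 8; 10; 2; 24; 30;
    25; 27; 28; 3; 6; 32; 0; 23; 33; 12; 26; 51; 37; 45; 49; 53; 41; 34; 47; 46; 36; 35; 38; 43;
    39; 40; 42; 48; 50; 44];
  [:: 12; 26; 34; 13; 27; 35; 14; 28; 36; 15; 29; 37; 16; 30; 38; 0; 31; 39; 1; 32; 40; 2; 33;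
    41; 3; 17; 42; 4; 18; 43; 5; 19; 44; 6; 20; 45; 7; 21; 46; 8; 22; 47; 9; 23; 48; 10; 24; 49;
    11; 25; 50];
  [:: 15; 17; 34; 16; 18; 35; 0; 19; 36; 1; 20; 37; 2; 21; 38; 3; 22; 39; 4; 23; 40; 5; 24; 41;
    6; 25; 42; 7; 26; 43; 8; 27; 44; 9; 28; 45; 10; 29; 46; 11; 30; 47; 12; 31; 48; 13; 32; 49;
    14; 33; 50]]%bn.
Lemma fillable_17 : fillable 3 2 (3 * 17).
Proof. by apply: (@holed_checkP 3 2 [:: 17; 17; 17]%bn base17); vm_compute. Qed.

Definition base18 : seq (seq bN) := [::
  [:: 20; 38; 54; 28; 40; 55; 47; 15; 4; 44; 35; 52; 25; 49; 29; 50; 3; 7; 39; 6; 16; 34; 22; 13;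
    2; 41; 8; 45; 32; 46; 48; 26; 36; 21; 5; 27; 23; 17; 18; 24; 1; 19; 43; 14; 11; 42; 53; 37;
    12; 51; 10; 33; 30; 31; 0; 9; 56];
  [:: 10; 40; 46; 30; 14; 9; 45; 53; 1; 33; 3; 34; 37; 29; 52; 20; 35; 5; 21; 6; 19; 39; 28; 43;
    2; 24; 15; 12; 13; 31; 8; 48; 55; 32; 38; 7; 25; 44; 41; 49; 4; 50; 23; 17; 0; 42; 11; 22;
    47; 26; 51; 16; 36; 54; 18; 27; 56];
  [:: 15; 3; 13; 35; 28; 51; 46; 19; 2; 25; 33; 40; 20; 39; 31; 7; 4; 11; 30; 5; 34; 0; 48; 26;
    47; 49; 12; 27; 44; 10; 14; 24; 55; 41; 52; 17; 6; 32; 42; 16; 18; 54; 43; 38; 1; 53; 22; 8;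
    23; 9; 37; 50; 21; 29; 36; 45; 56];
  [:: 0; 20; 38; 1; 21; 39; 2; 22; 40; 3; 23; 41; 4; 24; 42; 5; 25; 43; 6; 26; 44; 7; 27; 45; 8;
    28; 46; 9; 29; 47; 10; 30; 48; 11; 31; 49; 12; 32; 50; 13; 33; 51; 14; 34; 52; 15; 35; 53;
    16; 18; 36; 17; 19; 37];
  [:: 0; 28; 40; 1; 29; 41; 2; 30; 42; 3; 31; 43; 4; 32; 44; 5; 33; 45; 6; 34; 46; 7; 35; 47; 8;
    18; 48; 9; 19; 49; 10; 20; 50; 11; 21; 51; 12; 22; 52; 13; 23; 53; 14; 24; 36; 15; 25; 37;
    16; 26; 38; 17; 27; 39]]%bn.
Lemma fillable_18 : fillable 3 2 (3 * 18).
Proof. by apply: (@holed_checkP 3 2 [:: 18; 18; 18]%bn base18); vm_compute. Qed.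

Definition base22 : seq (seq bN) := [::
  [:: 40; 62; 66; 41; 46; 67; 26; 50; 2; 44; 38; 30; 63; 56; 37; 19; 32; 28; 18; 60; 13; 8; 45;
    51; 12; 23; 39; 3; 35; 31; 64; 17; 4; 29; 49; 58; 34; 52; 57; 21; 54; 15; 55; 1; 16; 5; 47;
    9; 33; 10; 27; 6; 61; 7; 14; 59; 65; 43; 53; 36; 24; 48; 20; 22; 25; 42; 0; 11; 68];
  [:: 64; 51; 15; 32; 47; 31; 24; 2; 27; 11; 21; 38; 29; 61; 8; 3; 49; 67; 4; 44; 66; 6; 50; 36;
    17; 28; 5; 48; 7; 63; 52; 53; 56; 34; 59; 43; 23; 35; 60; 12; 9; 40; 14; 58; 30; 54; 37; 1;
    16; 13; 26; 46; 20; 18; 10; 62; 45; 41; 19; 39; 57; 65; 55; 0; 25; 42; 22; 33; 68];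
  [:: 14; 26; 49; 7; 21; 50; 0; 38; 30; 24; 53; 17; 65; 35; 47; 45; 36; 48; 4; 22; 66; 3; 59; 40;
    31; 52; 64; 34; 27; 13; 2; 19; 6; 33; 46; 54; 51; 10; 25; 37; 57; 8; 42; 18; 16; 1; 15; 60;
    9; 43; 61; 29; 41; 28; 20; 39; 67; 11; 12; 5; 23; 58; 56; 62; 63; 32; 44; 55; 68];
  [:: 0; 40; 62; 1; 41; 63; 2; 42; 64; 3; 43; 65; 4; 22; 44; 5; 23; 45; 6; 24; 46; 7; 25; 47; 8;
    26; 48; 9; 27; 49; 10; 28; 50; 11; 29; 51; 12; 30; 52; 13; 31; 53; 14; 32; 54; 15; 33; 55;
    16; 34; 56; 17; 35; 57; 18; 36; 58; 19; 37; 59; 20; 38; 60; 21; 39; 61];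
  [:: 0; 41; 46; 1; 42; 47; 2; 43; 48; 3; 22; 49; 4; 23; 50; 5; 24; 51; 6; 25; 52; 7; 26; 53; 8;
    27; 54; 9; 28; 55; 10; 29; 56; 11; 30; 57; 12; 31; 58; 13; 32; 59; 14; 33; 60; 15; 34; 61;
    16; 35; 62; 17; 36; 63; 18; 37; 64; 19; 38; 65; 20; 39; 44; 21; 40; 45]]%bn.
Lemma fillable_22 : fillable 3 2 (3 * 22).
Proof. by apply: (@holed_checkP 3 2 [:: 22; 22; 22]%bn base22); vm_compute. Qed.

Definition base23 : seq (seq bN) := [::
  [:: 22; 35; 46; 1; 36; 47; 16; 44; 48; 6; 37; 49; 5; 19; 50; 34; 45; 51; 10; 30; 52; 12; 15;
    53; 9; 4; 54; 7; 28; 55; 41; 32; 56; 25; 26; 57; 40; 69; 58; 33; 70; 59; 21; 27; 60; 20; 8;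
    61; 2; 29; 62; 42; 38; 63; 3; 11; 64; 13; 43; 65; 17; 31; 66; 24; 39; 67; 14; 18; 68; 0; 23;
    71];
  [:: 33; 39; 46; 14; 32; 47; 8; 27; 48; 13; 70; 49; 18; 2; 50; 7; 31; 51; 1; 35; 52; 30; 40; 53;
    20; 45; 54; 21; 24; 55; 17; 19; 56; 11; 10; 57; 15; 9; 58; 36; 29; 59; 41; 44; 60; 5; 37; 61;
    43; 25; 62; 12; 34; 63; 6; 69; 64; 26; 28; 65; 22; 38; 66; 4; 42; 67; 3; 16; 68; 0; 23; 71];
  [:: 7; 9; 36; 6; 25; 44; 1; 15; 19; 14; 21; 42; 4; 17; 24; 12; 37; 38; 5; 8; 16; 18; 29; 40; 2;
    26; 41; 27; 30; 32; 3; 20; 34; 10; 43; 70; 0; 22; 35; 11; 28; 69; 13; 31; 45; 23; 33; 39; 54;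
    55; 63; 46; 49; 59; 57; 66; 68; 60; 64; 71; 51; 62; 67; 47; 52; 53; 48; 50; 56; 58; 61; 65];
  [:: 11; 28; 46; 12; 29; 47; 13; 30; 48; 14; 31; 49; 15; 32; 50; 16; 33; 51; 17; 34; 52; 18; 35;
    53; 19; 36; 54; 20; 37; 55; 21; 38; 56; 22; 39; 57; 0; 40; 58; 1; 41; 59; 2; 42; 60; 3; 43;
    61; 4; 44; 62; 5; 45; 63; 6; 23; 64; 7; 24; 65; 8; 25; 66; 9; 26; 67; 10; 27; 68];
  [:: 10; 43; 46; 11; 44; 47; 12; 45; 48; 13; 23; 49; 14; 24; 50; 15; 25; 51; 16; 26; 52; 17; 27;
    53; 18; 28; 54; 19; 29; 55; 20; 30; 56; 21; 31; 57; 22; 32; 58; 0; 33; 59; 1; 34; 60; 2; 35;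
    61; 3; 36; 62; 4; 37; 63; 5; 38; 64; 6; 39; 65; 7; 40; 66; 8; 41; 67; 9; 42; 68]]%bn.
Lemma fillable_23 : fillable 3 2 (3 * 23).
Proof. by apply: (@holed_checkP 3 2 [:: 23; 23; 23]%bn base23); vm_compute. Qed.

Definition base26 : seq (seq bN) := [::
  [:: 33; 74; 78; 31; 52; 79; 39; 18; 68; 45; 20; 9; 77; 43; 32; 44; 58; 21; 60; 14; 70; 47; 8;
    76; 25; 53; 29; 75; 38; 26; 1; 54; 30; 51; 6; 15; 49; 63; 5; 34; 19; 23; 59; 16; 71; 35; 57;
    40; 37; 22; 3; 50; 46; 27; 24; 64; 65; 48; 28; 61; 41; 4; 7; 2; 66; 67; 12; 72; 56; 36; 11;
    17; 69; 55; 10; 42; 62; 73; 0; 13; 80];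
  [:: 12; 47; 69; 11; 15; 18; 44; 43; 70; 23; 22; 76; 17; 74; 31; 10; 72; 57; 58; 42; 77; 75; 0;
    38; 1; 7; 16; 34; 51; 52; 13; 5; 55; 27; 35; 53; 66; 3; 8; 49; 45; 25; 60; 9; 41; 24; 46; 59;
    50; 62; 54; 48; 29; 2; 36; 68; 61; 19; 67; 78; 28; 64; 56; 21; 73; 79; 30; 33; 6; 4; 32; 65;
    63; 14; 40; 71; 37; 20; 26; 39; 80];
  [:: 0; 31; 79; 38; 15; 20; 5; 47; 67; 46; 36; 71; 4; 37; 78; 13; 11; 77; 14; 12; 53; 9; 64; 19;
    44; 1; 33; 40; 42; 70; 25; 24; 28; 17; 39; 45; 27; 59; 43; 21; 30; 35; 49; 10; 2; 3; 41; 29;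
    75; 69; 73; 26; 34; 51; 16; 32; 63; 48; 50; 60; 8; 68; 22; 55; 72; 76; 54; 57; 74; 66; 23; 7;
    58; 61; 56; 18; 6; 62; 52; 65; 80];
  [:: 0; 33; 74; 1; 34; 75; 2; 35; 76; 3; 36; 77; 4; 37; 52; 5; 38; 53; 6; 39; 54; 7; 40; 55; 8;
    41; 56; 9; 42; 57; 10; 43; 58; 11; 44; 59; 12; 45; 60; 13; 46; 61; 14; 47; 62; 15; 48; 63;
    16; 49; 64; 17; 50; 65; 18; 51; 66; 19; 26; 67; 20; 27; 68; 21; 28; 69; 22; 29; 70; 23; 30;
    71; 24; 31; 72; 25; 32; 73];
  [:: 0; 31; 52; 1; 32; 53; 2; 33; 54; 3; 34; 55; 4; 35; 56; 5; 36; 57; 6; 37; 58; 7; 38; 59; 8;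
    39; 60; 9; 40; 61; 10; 41; 62; 11; 42; 63; 12; 43; 64; 13; 44; 65; 14; 45; 66; 15; 46; 67;
    16; 47; 68; 17; 48; 69; 18; 49; 70; 19; 50; 71; 20; 51; 72; 21; 26; 73; 22; 27; 74; 23; 28;
    75; 24; 29; 76; 25; 30; 77]]%bn.
Lemma fillable_26 : fillable 3 2 (3 * 26).
Proof. by apply: (@holed_checkP 3 2 [:: 26; 26; 26]%bn base26); vm_compute. Qed.

Definition base30 : seq (seq bN) := [::
  [:: 32; 79; 90; 44; 64; 91; 48; 24; 40; 86; 17; 85; 38; 41; 77; 30; 81; 51; 31; 28; 12; 74; 67;
    76; 33; 2; 14; 54; 46; 6; 53; 72; 19; 63; 47; 36; 42; 29; 20; 78; 56; 61; 43; 21; 1; 71; 66;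
    26; 69; 13; 68; 4; 75; 70; 88; 80; 23; 34; 11; 83; 82; 39; 57; 58; 73; 35; 49; 16; 18; 25;
    84; 22; 37; 50; 60; 52; 9; 10; 65; 7; 87; 89; 5; 27; 3; 62; 8; 59; 55; 45; 0; 15; 92];
  [:: 72; 58; 84; 31; 36; 64; 1; 56; 46; 10; 47; 70; 81; 51; 0; 27; 29; 11; 32; 74; 86; 67; 61;
    71; 87; 41; 24; 34; 5; 50; 39; 60; 9; 73; 21; 48; 6; 52; 12; 23; 43; 83; 7; 79; 26; 44; 15;
    40; 53; 68; 25; 16; 80; 91; 82; 4; 65; 57; 66; 19; 38; 14; 20; 85; 42; 3; 75; 37; 2; 33; 69;
    22; 76; 49; 13; 78; 89; 62; 55; 88; 54; 28; 77; 90; 35; 63; 59; 17; 8; 18; 30; 45; 92];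
  [:: 66; 70; 59; 19; 85; 15; 21; 4; 89; 42; 71; 74; 61; 22; 5; 36; 78; 34; 24; 65; 20; 44; 33;
    27; 45; 52; 17; 39; 30; 9; 11; 43; 90; 77; 55; 29; 51; 54; 13; 88; 81; 14; 48; 46; 72; 2; 82;
    25; 83; 16; 62; 0; 37; 50; 76; 58; 87; 86; 80; 49; 79; 31; 63; 38; 12; 73; 41; 18; 7; 84; 64;
    53; 26; 40; 91; 67; 23; 69; 57; 32; 56; 1; 6; 28; 68; 10; 3; 47; 8; 35; 60; 75; 92];
  [:: 0; 32; 79; 1; 33; 80; 2; 34; 81; 3; 35; 82; 4; 36; 83; 5; 37; 84; 6; 38; 85; 7; 39; 86; 8;
    40; 87; 9; 41; 88; 10; 42; 89; 11; 43; 60; 12; 44; 61; 13; 45; 62; 14; 46; 63; 15; 47; 64;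
    16; 48; 65; 17; 49; 66; 18; 50; 67; 19; 51; 68; 20; 52; 69; 21; 53; 70; 22; 54; 71; 23; 55;
    72; 24; 56; 73; 25; 57; 74; 26; 58; 75; 27; 59; 76; 28; 30; 77; 29; 31; 78];
  [:: 0; 44; 64; 1; 45; 65; 2; 46; 66; 3; 47; 67; 4; 48; 68; 5; 49; 69; 6; 50; 70; 7; 51; 71; 8;
    52; 72; 9; 53; 73; 10; 54; 74; 11; 55; 75; 12; 56; 76; 13; 57; 77; 14; 58; 78; 15; 59; 79;
    16; 30; 80; 17; 31; 81; 18; 32; 82; 19; 33; 83; 20; 34; 84; 21; 35; 85; 22; 36; 86; 23; 37;
    87; 24; 38; 88; 25; 39; 89; 26; 40; 60; 27; 41; 61; 28; 42; 62; 29; 43; 63]]%bn.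
Lemma fillable_30 : fillable 3 2 (3 * 30).
Proof. by apply: (@holed_checkP 3 2 [:: 30; 30; 30]%bn base30); vm_compute. Qed.

(** * Two complete covers *)

(** The triangle taken twice; it fills groups of size two. *)
Lemma fillable1_2 : fillable 1 0 2.
Proof. by apply: (@holed_checkP 1 0 [:: 1; 1]%bn [:: [:: 0; 1; 2]; [:: 0; 1; 2]]%bn);
    vm_compute. Qed.

(** A class of twelve triples on the residues modulo 35 and the fixed point 35. Its 35 rotations
    form the cover for [q = 12]. *)
Definition starter35 : seq (seq bN) := [::
  [:: 28; 30; 34; 19; 20; 25; 12; 24; 26; 6; 17; 21; 9; 27; 32; 13; 16; 29; 0; 14; 35; 5; 8; 18;
    1; 2; 10; 7; 23; 33; 4; 15; 22; 3; 11; 31]]%bn.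
Lemma fillable1_35 : fillable 1 0 35.
Proof. by apply: (@holed_checkP 1 0 [:: 35]%bn starter35); vm_compute. Qed.

(** * Ingredient frames for Wilson's construction *)

Definition table_34 : seq (seq bN) := [::
  [:: 3; 6; 9; 4; 8; 10; 5; 7; 11];
  [:: 0; 6; 9; 1; 8; 11; 2; 7; 10];
  [:: 0; 3; 9; 1; 5; 10; 2; 4; 11];
  [:: 0; 3; 6; 1; 4; 7; 2; 5; 8];
  [:: 0; 4; 8; 1; 5; 6; 2; 3; 7];
  [:: 0; 5; 7; 1; 3; 8; 2; 4; 6]]%bn.
Definition group_34 : bN -> nat := fun p => nat_of_bin (BinNat.N.div p 3%bn).
(** The final weight 0 stands for an empty group: it serves blocks whose point in the last group of
    the design has weight zero. *)
Lemma ptype_frame_34 : exists s, frame (ptype [:: 1; 1; 1; 1; 0]) fst s.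
Proof. by apply: (@ptype_frame_check group_34 [:: 3; 3; 3; 1; 1; 1]%bn table_34); vm_compute. Qed.

Definition table_35 : seq (seq bN) := [::
  [:: 2; 13; 14; 6; 8; 4; 11; 12; 3; 1; 7; 9];
  [:: 7; 3; 4; 11; 13; 9; 1; 2; 8; 6; 12; 14];
  [:: 12; 8; 9; 1; 3; 14; 6; 7; 13; 11; 2; 4]]%bn.
Definition group_35 : bN -> nat := fun p => nat_of_bin (BinNat.N.modulo p 5%bn).
Lemma ptype_frame_35 : exists s, frame (ptype [:: 1; 1; 1; 1; 1]) fst s.
Proof. by apply: (@ptype_frame_check group_35 [:: 5; 5; 5]%bn table_35); vm_compute. Qed.

Definition table_37 : seq (seq bN) := [::
  [:: 1; 3; 13; 16; 5; 20; 15; 2; 19; 9; 10; 18; 17; 11; 12; 8; 4; 6];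
  [:: 8; 10; 20; 2; 12; 6; 1; 9; 5; 16; 17; 4; 3; 18; 19; 15; 11; 13];
  [:: 15; 17; 6; 9; 19; 13; 8; 16; 12; 2; 3; 11; 10; 4; 5; 1; 18; 20]]%bn.
Definition group_37 : bN -> nat := fun p => nat_of_bin (BinNat.N.modulo p 7%bn).
Lemma ptype_frame_37 : exists s, frame (ptype [:: 1; 1; 1; 1; 1; 1; 1; 0]) fst s.
Proof. by apply: (@ptype_frame_check group_37 [:: 7; 7; 7]%bn table_37); vm_compute. Qed.

Definition table_38 : seq (seq bN) := [::
  [:: 2; 12; 6; 17; 18; 7; 9; 11; 20; 19; 5; 22; 4; 21; 23; 1; 10; 13; 3; 14; 15];
  [:: 10; 20; 14; 1; 2; 15; 17; 19; 4; 3; 13; 6; 12; 5; 7; 9; 18; 21; 11; 22; 23];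
  [:: 18; 4; 22; 9; 10; 23; 1; 3; 12; 11; 21; 14; 20; 13; 15; 17; 2; 5; 19; 6; 7]]%bn.
Definition group_38 : bN -> nat := fun p => nat_of_bin (BinNat.N.modulo p 8%bn).
Lemma ptype_frame_38 : exists s, frame (ptype [:: 1; 1; 1; 1; 1; 1; 1; 1]) fst s.
Proof. by apply: (@ptype_frame_check group_38 [:: 8; 8; 8]%bn table_38); vm_compute. Qed.

Definition table_643 : seq (seq bN) := [::
  [:: 6; 12; 20; 7; 23; 26; 8; 16; 25; 9; 14; 21; 10; 13; 19; 11; 15; 18; 17; 22; 24];
  [:: 0; 12; 20; 1; 16; 19; 2; 15; 21; 3; 17; 18; 4; 14; 26; 5; 22; 25; 13; 23; 24];
  [:: 0; 6; 20; 1; 23; 25; 2; 10; 24; 3; 8; 21; 4; 7; 19; 5; 9; 18; 11; 22; 26];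
  [:: 0; 11; 15; 1; 8; 24; 2; 13; 26; 3; 6; 17; 4; 10; 16; 5; 9; 12; 7; 14; 25];
  [:: 0; 17; 22; 3; 14; 19; 1; 8; 18; 4; 11; 21; 2; 10; 12; 5; 7; 15; 6; 13; 23; 9; 16; 20]]%bn.
Definition group_643 : bN -> nat := fun p => nat_of_bin (BinNat.N.div p 6%bn).
Lemma ptype_frame_643 : exists s, frame (ptype [:: 2; 2; 2; 2; 1; 0]) fst s.
Proof. by apply: (@ptype_frame_check group_643 [:: 6; 6; 6; 6; 3]%bn table_643); vm_compute. Qed.

Definition table_65 : seq (seq bN) := [::
  [:: 1; 4; 22; 2; 8; 16; 3; 14; 21; 6; 13; 29; 7; 9; 23; 11; 12; 18; 17; 19; 26; 24; 27; 28];
  [:: 1; 7; 14; 2; 26; 29; 3; 16; 27; 4; 21; 23; 6; 18; 19; 8; 9; 12; 11; 22; 28; 13; 17; 24]]%bn.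
Definition group_65 : bN -> nat := fun p => nat_of_bin (BinNat.N.modulo p 5%bn).
Lemma ptype_frame_65 : exists s, frame (ptype [:: 2; 2; 2; 2; 2; 0]) fst s.
Proof. by apply: (@ptype_frame_check group_65 [:: 15; 15]%bn table_65); vm_compute. Qed.

Definition table_653 : seq (seq bN) := [::
  [:: 1; 7; 9; 2; 13; 14; 3; 11; 12; 4; 6; 8; 16; 27; 30; 17; 24; 32; 18; 26; 31; 19; 22; 23; 21;
    28; 29];
  [:: 1; 2; 8; 3; 4; 7; 6; 18; 24; 9; 17; 23; 11; 27; 29; 12; 26; 32; 13; 22; 30; 14; 21; 31; 16;
    19; 28];
  [:: 1; 3; 14; 2; 4; 11; 6; 22; 31; 7; 24; 30; 8; 29; 32; 9; 26; 28; 12; 18; 19; 13; 16; 17; 21;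
    23; 27];
  [:: 1; 23; 24; 2; 28; 31; 3; 22; 32; 4; 26; 30; 6; 17; 29; 7; 8; 21; 9; 18; 27; 11; 13; 19; 12;
    14; 16];
  [:: 1; 18; 32; 2; 16; 24; 3; 17; 21; 4; 27; 28; 6; 7; 19; 8; 11; 30; 9; 13; 31; 12; 23; 29; 14;
    22; 26];
  [:: 1; 22; 29; 2; 23; 26; 3; 19; 30; 4; 17; 31; 6; 12; 28; 7; 16; 18; 8; 14; 27; 9; 11; 32; 13;
    21; 24];
  [:: 0; 16; 27; 1; 17; 28; 2; 18; 29; 3; 19; 25; 4; 15; 26; 5; 13; 22; 6; 14; 23; 7; 10; 24; 8;
    11; 20; 9; 12; 21];
  [:: 0; 18; 26; 1; 19; 27; 2; 15; 28; 3; 16; 29; 4; 17; 25; 5; 14; 21; 6; 10; 22; 7; 11; 23; 8;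
    12; 24; 9; 13; 20];
  [:: 0; 17; 24; 1; 18; 20; 2; 19; 21; 3; 15; 22; 4; 16; 23; 5; 12; 26; 6; 13; 27; 7; 14; 28; 8;
    10; 29; 9; 11; 25]]%bn.
Definition group_653 : bN -> nat := fun p =>
  if p <b 30%bn then nat_of_bin (BinNat.N.modulo p 5%bn) else 5.
Lemma ptype_frame_653 : exists s, frame (ptype [:: 2; 2; 2; 2; 2; 1]) fst s.
Proof. by apply: (@ptype_frame_check group_653 [:: 5; 5; 5; 5; 5; 5; 1; 1; 1]%bn table_653);
    vm_compute. Qed.
(** The same table with the last two groups exchanged, for blocks whose point of weight 1 lies in
    the fifth group. *)
Lemma ptype_frame_653_swapped : exists s, frame (ptype [:: 2; 2; 2; 2; 1; 2]) fst s.
Proof. by apply: (@ptype_frame_check (fun p => nth 0 [:: 0; 1; 2; 3; 5; 4] (group_653 p)) [:: 5;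
    5; 5; 5; 5; 5; 1; 1; 1]%bn table_653); vm_compute. Qed.

Definition table_66 : seq (seq bN) := [::
  [:: 1; 5; 31; 2; 20; 24; 4; 17; 30; 7; 23; 28; 8; 19; 35; 10; 27; 29; 11; 21; 34; 13; 14; 26;
    16; 18; 22; 25; 32; 33];
  [:: 0; 16; 22; 1; 9; 20; 2; 13; 23; 3; 28; 35; 4; 19; 29; 5; 6; 10; 7; 17; 34; 8; 15; 31; 11;
    25; 26; 12; 14; 32]]%bn.
Definition group_66 : bN -> nat := fun p =>
  nat_of_bin (BinNat.N.modulo p 3%bn) + (if p <b 18%bn then 0 else 3).
Lemma ptype_frame_66 : exists s, frame (ptype [:: 2; 2; 2; 2; 2; 2]) fst s.
Proof. by apply: (@ptype_frame_check group_66 [:: 18; 18]%bn table_66); vm_compute. Qed.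

(** * Frames for orders outside the recursion *)

Definition table_12_6_15 : seq (seq bN) := [::
  [:: 1; 46; 82; 2; 67; 70; 3; 8; 40; 4; 21; 85; 5; 15; 37; 7; 63; 73; 9; 19; 28; 10; 13; 50; 11;
    56; 72; 14; 35; 84; 16; 65; 68; 17; 45; 81; 20; 33; 83; 22; 62; 74; 23; 44; 57; 25; 52; 71;
    26; 27; 78; 29; 61; 75; 31; 53; 64; 32; 47; 79; 34; 55; 59; 38; 43; 80; 39; 41; 77; 49; 69;
    86; 51; 58; 76];
  [:: 1; 15; 85; 2; 57; 61; 3; 23; 83; 4; 51; 80; 5; 40; 69; 7; 68; 76; 8; 17; 27; 9; 35; 78; 10;
    19; 79; 11; 45; 64; 13; 39; 70; 14; 58; 73; 16; 31; 81; 20; 49; 74; 21; 28; 53; 22; 71; 75;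
    25; 33; 50; 26; 29; 43; 32; 67; 77; 34; 47; 72; 37; 41; 52; 38; 55; 65; 44; 59; 86; 46; 56;
    84; 62; 63; 82];
  [:: 1; 32; 65; 2; 27; 55; 3; 61; 76; 4; 14; 17; 5; 56; 85; 7; 21; 80; 8; 9; 81; 10; 33; 67; 11;
    49; 79; 13; 52; 75; 15; 38; 77; 16; 41; 78; 19; 22; 29; 20; 39; 43; 23; 25; 73; 26; 64; 86;
    28; 69; 84; 31; 47; 50; 34; 63; 71; 35; 40; 51; 37; 58; 72; 44; 70; 82; 45; 59; 68; 46; 62;
    83; 53; 57; 74];
  [:: 1; 26; 53; 2; 4; 69; 3; 52; 86; 5; 7; 57; 8; 21; 43; 9; 16; 73; 10; 32; 72; 11; 22; 77; 13;
    29; 68; 14; 47; 75; 15; 20; 41; 17; 33; 58; 19; 23; 76; 25; 45; 62; 27; 71; 82; 28; 55; 83;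
    31; 39; 84; 34; 44; 85; 35; 37; 64; 38; 46; 81; 40; 49; 63; 50; 51; 74; 56; 61; 78; 59; 70;
    79; 65; 67; 80];
  [:: 0; 11; 56; 3; 14; 59; 6; 17; 62; 9; 2; 65; 12; 5; 68; 15; 8; 71; 1; 23; 63; 4; 26; 66; 7;
    29; 69; 10; 32; 54; 13; 35; 57; 16; 20; 60; 18; 34; 47; 21; 19; 50; 24; 22; 53; 27; 25; 38;
    30; 28; 41; 33; 31; 44; 36; 37; 58; 39; 40; 61; 42; 43; 64; 45; 46; 67; 48; 49; 70; 51; 52;
    55];
  [:: 0; 29; 61; 3; 32; 64; 6; 35; 67; 9; 20; 70; 12; 23; 55; 15; 26; 58; 1; 40; 42; 4; 43; 45;
    7; 46; 48; 10; 49; 51; 13; 52; 36; 16; 37; 39; 2; 53; 60; 5; 38; 63; 8; 41; 66; 11; 44; 69;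
    14; 47; 54; 17; 50; 57; 18; 22; 71; 21; 25; 56; 24; 28; 59; 27; 31; 62; 30; 34; 65; 33; 19;
    68];
  [:: 0; 26; 27; 3; 29; 30; 6; 32; 33; 9; 35; 18; 12; 20; 21; 15; 23; 24; 1; 39; 44; 4; 42; 47;
    7; 45; 50; 10; 48; 53; 13; 51; 38; 16; 36; 41; 2; 34; 49; 5; 19; 52; 8; 22; 37; 11; 25; 40;
    14; 28; 43; 17; 31; 46; 54; 56; 61; 57; 59; 64; 60; 62; 67; 63; 65; 70; 66; 68; 55; 69; 71;
    58];
  [:: 0; 17; 45; 3; 2; 48; 6; 5; 51; 9; 8; 36; 12; 11; 39; 15; 14; 42; 1; 21; 34; 4; 24; 19; 7;
    27; 22; 10; 30; 25; 13; 33; 28; 16; 18; 31; 20; 64; 65; 23; 67; 68; 26; 70; 71; 29; 55; 56;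
    32; 58; 59; 35; 61; 62; 37; 47; 63; 40; 50; 66; 43; 53; 69; 46; 38; 54; 49; 41; 57; 52; 44;
    60];
  [:: 0; 14; 35; 3; 17; 20; 6; 2; 23; 9; 5; 26; 12; 8; 29; 15; 11; 32; 1; 50; 70; 4; 53; 55; 7;
    38; 58; 10; 41; 61; 13; 44; 64; 16; 47; 67; 18; 46; 56; 21; 49; 59; 24; 52; 62; 27; 37; 65;
    30; 40; 68; 33; 43; 71; 19; 45; 60; 22; 48; 63; 25; 51; 66; 28; 36; 69; 31; 39; 54; 34; 42;
    57]]%bn.
Definition group_12_6_15 : bN -> nat := fun p =>
  if p <b 72%bn then nat_of_bin (BinNat.N.modulo p 6%bn) else 6.
(** The frame has six groups of 12 points and one of 15. Since [87 = 3 * 29], this settles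
    [n = 29]. *)
Lemma fillable_12_6_15 : fillable 3 2 12 -> fillable 3 2 15 -> fillable 3 2 87.
Proof.
move=> Fa Fb; apply: (@fillable_frame_check 3 2 group_12_6_15 [:: 18; 18; 18; 18; 3; 3; 3; 3;
    3]%bn table_12_6_15 (rcons (nseq 6 12) 15)).
- by vm_compute.
- by vm_compute.
- by move=> n; rewrite mem_rcons inE mem_nseq => /orP[/eqP->|/eqP->].
Qed.

Definition table_12_6_21 : seq (seq bN) := [::
  [:: 1; 29; 72; 2; 45; 81; 3; 47; 58; 4; 20; 35; 5; 27; 76; 7; 32; 86; 8; 49; 90; 9; 62; 71; 10;
    41; 91; 11; 25; 85; 13; 22; 77; 14; 31; 34; 15; 44; 55; 16; 43; 82; 17; 28; 74; 19; 70; 92;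
    21; 26; 88; 23; 40; 89; 33; 38; 80; 37; 51; 75; 39; 61; 84; 46; 63; 87; 50; 65; 73; 52; 57;
    59; 53; 67; 79; 56; 69; 83; 64; 68; 78];
  [:: 1; 5; 21; 2; 16; 33; 3; 41; 80; 4; 11; 84; 7; 8; 73; 9; 14; 76; 10; 31; 89; 13; 53; 87; 15;
    23; 88; 17; 69; 91; 19; 59; 62; 20; 70; 74; 22; 67; 83; 25; 51; 79; 26; 65; 77; 27; 37; 46;
    28; 57; 75; 29; 44; 78; 32; 63; 82; 34; 68; 72; 35; 58; 61; 38; 43; 81; 39; 47; 85; 40; 71;
    92; 45; 55; 90; 49; 50; 52; 56; 64; 86];
  [:: 1; 68; 80; 2; 59; 61; 3; 40; 75; 4; 69; 74; 5; 13; 92; 7; 10; 65; 8; 71; 89; 9; 11; 81; 14;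
    19; 88; 15; 58; 84; 16; 31; 78; 17; 50; 77; 20; 51; 52; 21; 28; 79; 22; 38; 53; 23; 37; 39;
    25; 46; 86; 26; 35; 45; 27; 64; 90; 29; 49; 83; 32; 67; 91; 33; 44; 85; 34; 41; 82; 43; 70;
    73; 47; 63; 72; 55; 62; 87; 56; 57; 76];
  [:: 1; 10; 63; 2; 21; 91; 3; 59; 83; 4; 68; 79; 5; 40; 78; 7; 39; 74; 8; 58; 80; 9; 37; 87; 11;
    50; 86; 13; 47; 70; 14; 17; 43; 15; 49; 56; 16; 67; 81; 19; 41; 90; 20; 22; 73; 23; 27; 82;
    25; 33; 75; 26; 64; 85; 28; 29; 69; 31; 32; 57; 34; 62; 84; 35; 44; 92; 38; 45; 72; 46; 65;
    88; 51; 71; 76; 52; 55; 77; 53; 61; 89];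
  [:: 0; 1; 29; 3; 4; 32; 6; 7; 35; 9; 10; 20; 12; 13; 23; 15; 16; 26; 2; 52; 67; 5; 37; 70; 8;
    40; 55; 11; 43; 58; 14; 46; 61; 17; 49; 64; 18; 34; 68; 21; 19; 71; 24; 22; 56; 27; 25; 59;
    30; 28; 62; 33; 31; 65; 36; 47; 63; 39; 50; 66; 42; 53; 69; 45; 38; 54; 48; 41; 57; 51; 44;
    60];
  [:: 0; 37; 51; 3; 40; 36; 6; 43; 39; 9; 46; 42; 12; 49; 45; 15; 52; 48; 1; 14; 23; 4; 17; 26;
    7; 2; 29; 10; 5; 32; 13; 8; 35; 16; 11; 20; 18; 28; 57; 21; 31; 60; 24; 34; 63; 27; 19; 66;
    30; 22; 69; 33; 25; 54; 38; 58; 59; 41; 61; 62; 44; 64; 65; 47; 67; 68; 50; 70; 71; 53; 55;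
    56];
  [:: 0; 64; 68; 3; 67; 71; 6; 70; 56; 9; 55; 59; 12; 58; 62; 15; 61; 65; 1; 34; 39; 4; 19; 42;
    7; 22; 45; 10; 25; 48; 13; 28; 51; 16; 31; 36; 2; 37; 69; 5; 40; 54; 8; 43; 57; 11; 46; 60;
    14; 49; 63; 17; 52; 66; 18; 29; 44; 21; 32; 47; 24; 35; 50; 27; 20; 53; 30; 23; 38; 33; 26;
    41];
  [:: 0; 2; 45; 3; 5; 48; 6; 8; 51; 9; 11; 36; 12; 14; 39; 15; 17; 42; 1; 57; 70; 4; 60; 55; 7;
    63; 58; 10; 66; 61; 13; 69; 64; 16; 54; 67; 18; 38; 43; 21; 41; 46; 24; 44; 49; 27; 47; 52;
    30; 50; 37; 33; 53; 40; 19; 23; 68; 22; 26; 71; 25; 29; 56; 28; 32; 59; 31; 35; 62; 34; 20;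
    65];
  [:: 0; 39; 61; 3; 42; 64; 6; 45; 67; 9; 48; 70; 12; 51; 55; 15; 36; 58; 1; 8; 33; 4; 11; 18; 7;
    14; 21; 10; 17; 24; 13; 2; 27; 16; 5; 30; 19; 57; 65; 22; 60; 68; 25; 63; 71; 28; 66; 56; 31;
    69; 59; 34; 54; 62; 20; 41; 49; 23; 44; 52; 26; 47; 37; 29; 50; 40; 32; 53; 43; 35; 38; 46];
  [:: 0; 46; 63; 3; 49; 66; 6; 52; 69; 9; 37; 54; 12; 40; 57; 15; 43; 60; 1; 24; 41; 4; 27; 44;
    7; 30; 47; 10; 33; 50; 13; 18; 53; 16; 21; 38; 2; 23; 28; 5; 26; 31; 8; 29; 34; 11; 32; 19;
    14; 35; 22; 17; 20; 25; 36; 55; 62; 39; 58; 65; 42; 61; 68; 45; 64; 71; 48; 67; 56; 51; 70;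
    59];
  [:: 0; 8; 49; 3; 11; 52; 6; 14; 37; 9; 17; 40; 12; 2; 43; 15; 5; 46; 1; 20; 71; 4; 23; 56; 7;
    26; 59; 10; 29; 62; 13; 32; 65; 16; 35; 68; 18; 45; 55; 21; 48; 58; 24; 51; 61; 27; 36; 64;
    30; 39; 67; 33; 42; 70; 19; 41; 54; 22; 44; 57; 25; 47; 60; 28; 50; 63; 31; 53; 66; 34; 38;
    69]]%bn.
Definition group_12_6_21 : bN -> nat := fun p =>
  if p <b 72%bn then nat_of_bin (BinNat.N.modulo p 6%bn) else 6.
(** Since [93 = 3 * 31], this settles [n = 31]. *)
Lemma fillable_12_6_21 : fillable 3 2 12 -> fillable 3 2 21 -> fillable 3 2 93.
Proof.
move=> Fa Fb; apply: (@fillable_frame_check 3 2 group_12_6_21 [:: 18; 18; 18; 18; 3; 3; 3; 3; 3;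
    3; 3]%bn table_12_6_21 (rcons (nseq 6 12) 21)).
- by vm_compute.
- by vm_compute.
- by move=> n; rewrite mem_rcons inE mem_nseq => /orP[/eqP->|/eqP->].
Qed.

Definition table_2_24_17 : seq (seq bN) := [::
  [:: 1; 35; 56; 2; 45; 60; 3; 22; 37; 4; 8; 63; 5; 23; 57; 7; 18; 58; 9; 19; 46; 10; 43; 61; 11;
    34; 55; 12; 38; 41; 13; 30; 53; 14; 32; 59; 15; 17; 62; 16; 29; 51; 20; 21; 48; 24; 25; 33;
    26; 28; 49; 27; 39; 64; 31; 40; 54; 36; 47; 50; 42; 44; 52];
  [:: 0; 38; 41; 1; 6; 58; 2; 5; 39; 3; 23; 48; 4; 13; 49; 7; 22; 60; 8; 25; 53; 9; 14; 62; 10;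
    30; 57; 11; 29; 52; 15; 35; 43; 16; 20; 64; 17; 47; 54; 19; 42; 55; 21; 32; 40; 24; 37; 63;
    26; 33; 61; 27; 45; 51; 28; 44; 56; 31; 46; 50; 34; 36; 59];
  [:: 0; 25; 33; 1; 2; 54; 3; 27; 28; 4; 18; 57; 5; 45; 56; 6; 19; 53; 7; 23; 52; 8; 34; 48; 9;
    36; 64; 10; 26; 50; 11; 32; 35; 12; 37; 63; 13; 16; 44; 14; 38; 58; 15; 29; 61; 17; 39; 49;
    20; 40; 55; 21; 42; 51; 22; 31; 62; 41; 46; 59; 43; 47; 60];
  [:: 0; 47; 50; 1; 37; 48; 2; 11; 21; 3; 5; 60; 4; 46; 53; 6; 38; 52; 7; 19; 45; 8; 27; 56; 9;
    24; 64; 10; 22; 39; 12; 34; 59; 13; 18; 55; 14; 33; 49; 15; 30; 51; 16; 32; 54; 17; 20; 28;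
    23; 35; 63; 25; 44; 61; 26; 43; 58; 29; 40; 62; 31; 41; 57];
  [:: 0; 20; 21; 3; 23; 12; 6; 14; 15; 9; 17; 18; 1; 36; 37; 4; 39; 40; 7; 42; 43; 10; 45; 46; 2;
    28; 30; 5; 31; 33; 8; 34; 24; 11; 25; 27; 13; 32; 47; 16; 35; 38; 19; 26; 41; 22; 29; 44];
  [:: 0; 16; 29; 3; 19; 32; 6; 22; 35; 9; 13; 26; 1; 14; 31; 4; 17; 34; 7; 20; 25; 10; 23; 28; 2;
    44; 46; 5; 47; 37; 8; 38; 40; 11; 41; 43; 12; 27; 45; 15; 30; 36; 18; 33; 39; 21; 24; 42];
  [:: 0; 31; 40; 3; 34; 43; 6; 25; 46; 9; 28; 37; 1; 2; 24; 4; 5; 27; 7; 8; 30; 10; 11; 33; 12;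
    17; 47; 15; 20; 38; 18; 23; 41; 21; 14; 44; 13; 29; 45; 16; 32; 36; 19; 35; 39; 22; 26; 42];
  [:: 0; 5; 23; 3; 8; 14; 6; 11; 17; 9; 2; 20; 1; 15; 33; 4; 18; 24; 7; 21; 27; 10; 12; 30; 13;
    35; 37; 16; 26; 40; 19; 29; 43; 22; 32; 46; 25; 42; 47; 28; 45; 38; 31; 36; 41; 34; 39; 44];
  [:: 0; 2; 45; 3; 5; 36; 6; 8; 39; 9; 11; 42; 1; 16; 18; 4; 19; 21; 7; 22; 12; 10; 13; 15; 14;
    28; 35; 17; 31; 26; 20; 34; 29; 23; 25; 32; 24; 43; 47; 27; 46; 38; 30; 37; 41; 33; 40; 44];
  [:: 0; 4; 8; 1; 5; 9; 2; 6; 10; 3; 7; 11; 12; 24; 37; 13; 25; 38; 14; 26; 39; 15; 27; 40; 16;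
    28; 41; 17; 29; 42; 18; 30; 43; 19; 31; 44; 20; 32; 45; 21; 33; 46; 22; 34; 47; 23; 35; 36];
  [:: 0; 27; 39; 1; 28; 40; 2; 29; 41; 3; 30; 42; 4; 31; 43; 5; 32; 44; 6; 33; 45; 7; 34; 46; 8;
    35; 47; 9; 24; 36; 10; 25; 37; 11; 26; 38; 12; 16; 20; 13; 17; 21; 14; 18; 22; 15; 19;
    23]]%bn.
Definition group_2_24_17 : bN -> nat := fun p =>
  if p <b 48%bn then nat_of_bin (BinNat.N.modulo p 6%bn)
    + 6 * nat_of_bin (BinNat.N.div p 12%bn) else 24.
(** Since [65 = 3 * 22 - 1], this serves [q = 22]; the large group, of size [17 = 3 * 5 + 2],
    receives the closed cover obtained from [n = 5]. *)
Lemma fillable_2_24_17 : fillable 1 0 2 -> fillable 1 0 17 -> fillable 1 0 65.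
Proof.
move=> Fa Fb; apply: (@fillable_frame_check 1 0 group_2_24_17 [:: 12; 12; 12; 12; 3; 3; 3; 3; 3;
    1; 1]%bn table_2_24_17 (rcons (nseq 24 2) 17)).
- by vm_compute.
- by vm_compute.
- by move=> n; rewrite mem_rcons inE mem_nseq => /orP[/eqP->|/eqP->].
Qed.

Definition table_2_30_23 : seq (seq bN) := [::
  [:: 1; 32; 75; 2; 59; 74; 3; 52; 58; 4; 33; 63; 5; 10; 81; 6; 20; 23; 7; 42; 71; 8; 35; 70; 9;
    17; 29; 11; 44; 65; 12; 49; 55; 13; 57; 72; 14; 31; 77; 16; 24; 62; 18; 50; 79; 19; 37; 61;
    21; 45; 69; 22; 39; 66; 25; 27; 67; 26; 40; 76; 28; 34; 78; 30; 56; 68; 36; 54; 64; 38; 48;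
    60; 41; 46; 82; 43; 47; 80; 51; 53; 73];
  [:: 1; 10; 18; 2; 36; 80; 3; 28; 67; 4; 44; 77; 5; 17; 66; 6; 22; 62; 7; 13; 27; 8; 32; 68; 9;
    54; 69; 11; 33; 60; 12; 47; 79; 14; 23; 61; 16; 40; 63; 19; 35; 72; 20; 25; 82; 21; 48; 51;
    24; 45; 57; 26; 31; 74; 29; 39; 65; 30; 52; 81; 34; 38; 73; 37; 53; 70; 41; 58; 76; 42; 56;
    78; 43; 55; 71; 46; 50; 75; 49; 59; 64];
  [:: 0; 56; 68; 1; 12; 63; 2; 49; 79; 3; 10; 71; 4; 50; 82; 5; 16; 75; 6; 28; 66; 7; 55; 61; 8;
    27; 60; 9; 48; 64; 11; 24; 80; 13; 14; 76; 15; 52; 81; 17; 57; 70; 18; 59; 78; 19; 47; 77;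
    20; 21; 65; 22; 41; 74; 23; 46; 69; 25; 29; 73; 26; 34; 72; 31; 33; 40; 32; 39; 44; 35; 36;
    38; 37; 42; 43; 51; 58; 62; 53; 54; 67];
  [:: 0; 21; 69; 1; 3; 72; 2; 5; 54; 4; 34; 66; 6; 42; 64; 7; 58; 74; 8; 11; 51; 9; 47; 73; 10;
    28; 80; 12; 35; 60; 13; 41; 78; 14; 40; 82; 15; 24; 57; 16; 50; 65; 17; 43; 75; 18; 27; 48;
    19; 31; 79; 20; 33; 70; 22; 44; 71; 23; 38; 81; 25; 56; 76; 26; 55; 63; 29; 49; 77; 32; 53;
    61; 36; 59; 67; 37; 46; 68; 39; 52; 62];
  [:: 0; 38; 48; 3; 41; 51; 6; 44; 54; 9; 32; 57; 12; 35; 45; 1; 17; 25; 4; 20; 28; 7; 23; 16;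
    10; 26; 19; 13; 29; 22; 2; 21; 39; 5; 24; 42; 8; 27; 30; 11; 15; 33; 14; 18; 36; 31; 52; 59;
    34; 55; 47; 37; 58; 50; 40; 46; 53; 43; 49; 56];
  [:: 0; 4; 33; 3; 7; 36; 6; 10; 39; 9; 13; 42; 12; 1; 30; 2; 38; 56; 5; 41; 59; 8; 44; 47; 11;
    32; 50; 14; 35; 53; 15; 16; 40; 18; 19; 43; 21; 22; 31; 24; 25; 34; 27; 28; 37; 17; 46; 51;
    20; 49; 54; 23; 52; 57; 26; 55; 45; 29; 58; 48];
  [:: 0; 22; 39; 3; 25; 42; 6; 28; 30; 9; 16; 33; 12; 19; 36; 1; 31; 57; 4; 34; 45; 7; 37; 48;
    10; 40; 51; 13; 43; 54; 2; 27; 29; 5; 15; 17; 8; 18; 20; 11; 21; 23; 14; 24; 26; 32; 55; 56;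
    35; 58; 59; 38; 46; 47; 41; 49; 50; 44; 52; 53];
  [:: 0; 21; 45; 3; 24; 48; 6; 27; 51; 9; 15; 54; 12; 18; 57; 1; 8; 43; 4; 11; 31; 7; 14; 34; 10;
    2; 37; 13; 5; 40; 16; 44; 56; 19; 32; 59; 22; 35; 47; 25; 38; 50; 28; 41; 53; 17; 39; 55; 20;
    42; 58; 23; 30; 46; 26; 33; 49; 29; 36; 52];
  [:: 0; 13; 57; 3; 1; 45; 6; 4; 48; 9; 7; 51; 12; 10; 54; 2; 53; 55; 5; 56; 58; 8; 59; 46; 11;
    47; 49; 14; 50; 52; 15; 19; 35; 18; 22; 38; 21; 25; 41; 24; 28; 44; 27; 16; 32; 17; 36; 40;
    20; 39; 43; 23; 42; 31; 26; 30; 34; 29; 33; 37];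
  [:: 0; 1; 32; 3; 4; 35; 6; 7; 38; 9; 10; 41; 12; 13; 44; 2; 28; 42; 5; 16; 30; 8; 19; 33; 11;
    22; 36; 14; 25; 39; 15; 46; 50; 18; 49; 53; 21; 52; 56; 24; 55; 59; 27; 58; 47; 17; 43; 45;
    20; 31; 48; 23; 34; 51; 26; 37; 54; 29; 40; 57];
  [:: 0; 28; 34; 3; 16; 37; 6; 19; 40; 9; 22; 43; 12; 25; 31; 1; 44; 48; 4; 32; 51; 7; 35; 54;
    10; 38; 57; 13; 41; 45; 2; 20; 52; 5; 23; 55; 8; 26; 58; 11; 29; 46; 14; 17; 49; 15; 42; 56;
    18; 30; 59; 21; 33; 47; 24; 36; 50; 27; 39; 53];
  [:: 0; 5; 10; 1; 6; 11; 2; 7; 12; 3; 8; 13; 4; 9; 14; 15; 30; 52; 16; 31; 53; 17; 32; 54; 18;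
    33; 55; 19; 34; 56; 20; 35; 57; 21; 36; 58; 22; 37; 59; 23; 38; 45; 24; 39; 46; 25; 40; 47;
    26; 41; 48; 27; 42; 49; 28; 43; 50; 29; 44; 51];
  [:: 0; 41; 46; 1; 42; 47; 2; 43; 48; 3; 44; 49; 4; 30; 50; 5; 31; 51; 6; 32; 52; 7; 33; 53; 8;
    34; 54; 9; 35; 55; 10; 36; 56; 11; 37; 57; 12; 38; 58; 13; 39; 59; 14; 40; 45; 15; 20; 25;
    16; 21; 26; 17; 22; 27; 18; 23; 28; 19; 24; 29]]%bn.
Definition group_2_30_23 : bN -> nat := fun p =>
  if p <b 60%bn then nat_of_bin (BinNat.N.modulo p 15%bn)
    + 15 * nat_of_bin (BinNat.N.div p 30%bn) else 30.
(** Since [83 = 3 * 28 - 1], this serves [q = 28]; here [23 = 3 * 7 + 2] comes from [n = 7]. *)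
Lemma fillable_2_30_23 : fillable 1 0 2 -> fillable 1 0 23 -> fillable 1 0 83.
Proof.
move=> Fa Fb; apply: (@fillable_frame_check 1 0 group_2_30_23 [:: 15; 15; 15; 15; 3; 3; 3; 3; 3;
    3; 3; 1; 1]%bn table_2_30_23 (rcons (nseq 30 2) 23)).
- by vm_compute.
- by vm_compute.
- by move=> n; rewrite mem_rcons inE mem_nseq => /orP[/eqP->|/eqP->].
Qed.

(** * The recursion *)

Lemma seq_choice (S : eqType) (V : Type) (R : S -> V -> Prop) (v0 : V) (ws : seq S) :
  (forall w, w \in ws -> exists t, R w t) -> exists t, forall w, w \in ws -> R w (t w).
Proof.
elim: ws => [|w ws IH] H; first by exists (fun _ => v0).
have [|t Ht] := IH; first by move=> u wu; apply: H; rewrite inE wu orbT.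
have [u Hu] := H w (mem_head _ _).
exists (fun z => if z == w then u else t z) => z; rewrite inE.
by case: eqP => [-> _|_ /= /Ht].
Qed.

(** The weight sequences that blocks may show in the three constructions below. The sequence
    [2, 2, 2, 2, 1, 1] is absent, which explains the parity condition in [fillable_8met]. *)
Definition patterns : seq (seq nat) :=
  [:: [:: 1; 1; 1; 1; 0]; [:: 1; 1; 1; 1; 1];
      [:: 1; 1; 1; 1; 1; 1; 1; 0]; [:: 1; 1; 1; 1; 1; 1; 1; 1];
      [:: 2; 2; 2; 2; 1; 0]; [:: 2; 2; 2; 2; 2; 0];
      [:: 2; 2; 2; 2; 1; 2]; [:: 2; 2; 2; 2; 2; 1]; [:: 2; 2; 2; 2; 2; 2]].

Lemma pattern_frames : exists t, forall w, w \in patterns -> frame (ptype w) fst (t w).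
Proof.
apply: (@seq_choice _ _ (fun w => frame (ptype w) fst) (fun _ x => x)) => w; rewrite !inE.
case/or4P => [||| /or4P[||| /or3P[]]] /eqP->.
- exact: ptype_frame_34.
- exact: ptype_frame_35.
- exact: ptype_frame_37.
- exact: ptype_frame_38.
- exact: ptype_frame_643.
- exact: ptype_frame_65.
- exact: ptype_frame_653_swapped.
- exact: ptype_frame_653.
- exact: ptype_frame_66.
Qed.

(** The weights are tested on every choice of one point per group, not only on blocks, so the test
    does not depend on the design. *)
Lemma fillable_patterns k m wt : has_td k m ->
    (forall f, (forall c, c < k -> f c < m) -> [seq wt c (f c) | c <- iota 0 k] \in patterns) ->
    (forall c, c < k -> fillable 3 2 (3 * sumn [seq wt c x | x <- iota 0 m])) ->
  fillable 3 2 (3 * sumn [seq sumn [seq wt c x | x <- iota 0 m] | c <- iota 0 k]).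
Proof.
move=> [B [L [J T]]] Hw; have [t Ht] := pattern_frames.
apply: (fillable_wfc T (t := t)) => b; apply: Ht.
by apply: (Hw (fun c => L c b)) => c ck; exact: (td_lt T).
Qed.

Lemma sumn_iotaS (f : nat -> nat) m :
  sumn [seq f x | x <- iota 0 m.+1] = sumn [seq f x | x <- iota 0 m] + f m.
Proof. by rewrite -addn1 iotaD map_cat sumn_cat /= addn0. Qed.

Lemma sumn_lt a m : sumn [seq nat_of_bool (x < a) | x <- iota 0 m] = minn a m.
Proof. by elim: m => [|m IH]; [rewrite minn0 | rewrite sumn_iotaS IH; lia]. Qed.

Lemma sumn_const c m : sumn [seq c | x <- iota 0 m] = c * m.
Proof. by elim: m => [|m IH]; rewrite ?muln0 // sumn_iotaS IH mulnS addnC. Qed.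

Lemma sumn_add (f g : nat -> nat) m :
  sumn [seq f x + g x | x <- iota 0 m] =
  sumn [seq f x | x <- iota 0 m] + sumn [seq g x | x <- iota 0 m].
Proof. by elim: m => [|m IH] //; rewrite !sumn_iotaS IH; lia. Qed.

(** Weight 1 on four groups and on [t] points of the fifth: the blocks carry frames of type 3^4 or
    3^5. *)
Lemma fillable_4mt m t : has_td 5 m -> t <= m ->
  fillable 3 2 (3 * m) -> fillable 3 2 (3 * t) -> fillable 3 2 (3 * (4 * m + t)).
Proof.
move=> T tm Fm Ft.
pose wt c x := if c < 4 then 1 else nat_of_bool (x < t).
have sz c : sumn [seq wt c x | x <- iota 0 m] = if c < 4 then m else t.
  by rewrite /wt; case: ifP => _; rewrite ?sumn_const ?mul1n // sumn_lt (minn_idPl tm).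
rewrite (_ : 4 * m + t = sumn [seq sumn [seq wt c x | x <- iota 0 m] | c <- iota 0 5]).
  apply: fillable_patterns T _ _ => [f _ /=|c _]; first by rewrite /wt /=; case: ltnP.
  by rewrite sz; case: ifP.
by rewrite /= !sz /=; lia.
Qed.

(** The same with eight groups and frames of type 3^7 or 3^8. *)
Lemma fillable_7mt m t : has_td 8 m -> t <= m ->
  fillable 3 2 (3 * m) -> fillable 3 2 (3 * t) -> fillable 3 2 (3 * (7 * m + t)).
Proof.
move=> T tm Fm Ft.
pose wt c x := if c < 7 then 1 else nat_of_bool (x < t).
have sz c : sumn [seq wt c x | x <- iota 0 m] = if c < 7 then m else t.
  by rewrite /wt; case: ifP => _; rewrite ?sumn_const ?mul1n // sumn_lt (minn_idPl tm).
rewrite (_ : 7 * m + t = sumn [seq sumn [seq wt c x | x <- iota 0 m] | c <- iota 0 8]).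
  apply: fillable_patterns T _ _ => [f _ /=|c _]; first by rewrite /wt /=; case: ltnP.
  by rewrite sz; case: ifP.
by rewrite /= !sz /=; lia.
Qed.

(** Weight 2 on four groups, weights 1 and 2 of total [e] on the fifth, weights 0, 1, 2 of total [t]
    on the sixth. An odd [t] puts weight 1 on one point of the sixth group, so then the fifth must
    have weight 2 throughout. *)
Lemma fillable_8met m e t : has_td 6 m -> m <= e <= 2 * m -> t <= 2 * m ->
    ~~ odd t || (e == 2 * m) ->
    fillable 3 2 (3 * (2 * m)) -> fillable 3 2 (3 * e) -> fillable 3 2 (3 * t) ->
  fillable 3 2 (3 * (8 * m + e + t)).
Proof.
move=> T /andP[me em] tm par Fm Fe Ft.
(* The two indicator functions in the sixth group add up to 2 on the first [t./2] points and to 1 on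
   the next point exactly when [t] is odd. *)
pose wt c x := if c < 4 then 2 else if c < 5 then 1 + (x < e - m) else (x < uphalf t) + (x < t./2).
have sz c : sumn [seq wt c x | x <- iota 0 m] = if c < 4 then 2 * m else if c < 5 then e else t.
  rewrite /wt; case: ifP => _; first by rewrite sumn_const.
  case: ifP => _; rewrite sumn_add ?sumn_const !sumn_lt; lia.
rewrite (_ : 8 * m + e + t = sumn [seq sumn [seq wt c x | x <- iota 0 m] | c <- iota 0 6]).
  apply: fillable_patterns T _ _ => [f fm|c _]; last by rewrite sz; do 2?case: ifP.
  have := fm 4 isT; rewrite /= /wt /= => f4.
  case x: (f 4 < e - m); case y: (f 5 < uphalf t); case z: (f 5 < t./2) => //; lia.
by rewrite /= !sz /=; lia.
Qed.

(** * The induction on the order *)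

Definition good n := (n == 0) || ((4 <= n) && (n \notin [:: 11; 13; 15; 19; 21; 27])).

Definition td_order m := (1 < m) && (coprime m 6 || (m \in [:: 8; 9])).

Lemma has_td_order m : td_order m -> has_td 6 m.
Proof.
case/andP=> m1 /orP[co|]; first exact: has_td_coprime6.
rewrite !inE => /orP[]/eqP->.
- by apply: (@has_td_primepower 5 2 3).
- by apply: (@has_td_primepower 5 3 2).
Qed.

(* [if] rather than [&&], which call-by-value evaluation makes strict *)
Definition decomposes n :=
  [|| (56 <= n) && good (n - 56) && (n - 56 <= 8) |
   has (fun m => if td_order m then
     [&& 4 * m <= n, n - 4 * m <= m, good m & good (n - 4 * m)] ||
     (if [&& 9 * m <= n, n <= 12 * m & good (2 * m)] then
       has (fun e => [&& m <= e <= 2 * m, 8 * m + e <= n, n - (8 * m + e) <= 2 * m,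
         ~~ odd (n - (8 * m + e)) || (e == 2 * m), good e & good (n - (8 * m + e))])
         (iota m m.+1) else false) else false)
     (iota 5 (n %/ 4))].

Lemma decomposes_fillable n : decomposes n ->
  (forall k, k < n -> good k -> fillable 3 2 (3 * k)) -> fillable 3 2 (3 * n).
Proof.
move=> dec IH; case/orP: dec => [/andP[/andP[n56 g] le]|].
  (* Here 56 is [7 * 8]: the design has eight groups over the field with eight elements. *)
  rewrite -(subnKC n56); apply: (@fillable_7mt 8) => //.
  - by apply: (@has_td_primepower 7 2 3).
  - by apply: IH => //; lia.
  - by apply: IH => //; lia.
case/hasP=> m _; case: ifP => // tdm; have m1 : 1 < m by case/andP: tdm.
case/orP=> [/and4P[mn le gm gt]|]; last first.
  case: ifP => // /and3P[_ _ gm] /hasP[e _ /and5P[me en le par /andP[ge gt]]].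
  rewrite -(subnKC en); apply: fillable_8met => //.
  - exact: has_td_order.
  - by apply: IH => //; lia.
  - by apply: IH => //; lia.
  - by apply: IH => //; lia.
rewrite -(subnKC mn); apply: fillable_4mt => //.
- exact: has_td_le (has_td_order tdm).
- by apply: IH => //; lia.
- by apply: IH => //; lia.
Qed.

(** Consecutive integers prime to 6 differ by at most 4, so some such [m] has
    [9 * m <= n < 9 * m + 36]. As [n >= 360] forces [m > 36], the choice [e = n - 8 * m], [t = 0]
    satisfies [m <= e <= 2 * m]. *)
Lemma decomposes_large n : 360 <= n -> decomposes n.
Proof.
move=> n360; apply/orP; right.
have [m [m6 mn nm]] : exists m, [/\ coprime m 6, 9 * m <= n & n < 9 * m + 36].
  have : exists m, [/\ (m %% 6 == 1) || (m %% 6 == 5), 9 * m <= n & n < 9 * m + 36].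
    (* The period is [54 = 9 * 6]; the remainder selects [m] among [6k - 1], [6k + 1] and
       [6k + 5]. *)
    have [k [r [Ek r54]]] : exists k r, n = 54 * k + r /\ r < 54.
      by exists (n %/ 54), (n %% 54); split; lia.
    have [r9|r9] := ltnP r 9; first by exists (6 * k).-1; split; lia.
    have [r45|r45] := ltnP r 45; last by exists (6 * k + 5); split; lia.
    by exists (6 * k + 1); split; lia.
  by case=> m [r mn nm]; exists m; split=> //; rewrite -coprime_modl; case/orP: r => /eqP->.
have big k : 28 <= k -> good k.
  by move=> k28; rewrite /good !inE; do ?[apply/orP; right]; apply/andP; split; lia.
apply/hasP; exists m; first by rewrite mem_iota; lia.
rewrite ifT; last by rewrite /td_order m6 /= andbT; lia.
rewrite ifT; last by apply/and3P; split; [lia | lia | apply: big; lia].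
apply/orP; right; apply/hasP; exists (n - 8 * m); first by rewrite mem_iota; lia.
have -> : n - (8 * m + (n - 8 * m)) = 0 by lia.
have ge : good (n - 8 * m) by apply: big; lia.
by rewrite ge; apply/and5P; split=> //; lia.
Qed.

Definition direct := [:: 0; 4; 5; 6; 7; 8; 9; 10; 12; 14; 16; 17; 18; 22; 23; 26; 29; 30; 31].

Lemma direct_fillable n : n \in direct -> fillable 3 2 (3 * n).
Proof.
have [F4 F5 F7] := And3 fillable_4 fillable_5 fillable_7.
rewrite !inE; do 18![case/orP; first by move=> /eqP->;
  first [exact: fillable0 | exact: fillable_4 | exact: fillable_5 | exact: fillable_6
    | exact: fillable_7 | exact: fillable_8 | exact: fillable_9 | exact: fillable_10
    | exact: fillable_12 | exact: fillable_14 | exact: fillable_16 | exact: fillable_17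
    | exact: fillable_18 | exact: fillable_22 | exact: fillable_23 | exact: fillable_26
    | exact: fillable_30 | exact: (fillable_12_6_15 F4 F5)]].
move=> /eqP->; exact: (fillable_12_6_21 F4 F7).
Qed.

Lemma decomposes_small :
  all (fun n => good n ==> (n \in direct) || decomposes n) (iota 0 360).
Proof. by vm_compute. Qed.

Lemma good_fillable n : good n -> fillable 3 2 (3 * n).
Proof.
elim/ltn_ind: n => n IH gn; have [n360|n360] := ltnP n 360; last first.
  exact: decomposes_fillable (decomposes_large n360) IH.
have /allP/(_ n) := decomposes_small; rewrite mem_iota => /(_ n360)/implyP/(_ gn)/orP[].
  exact: direct_fillable.
by move/decomposes_fillable; apply.
Qed.

(* The three points of the hole become one more triple, common to the two classes missing them. *)
Lemma fillable_close g : fillable 3 2 g -> fillable 1 0 (g + 2).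
Proof.
case=> s H; pose D x := x < g.
(* The three hole points are rotated by [rot]; in [s2] the two classes missing the hole acquire this
   triple. *)
pose rot (i : nat) := if i == 0 then 1 else if i == 1 then 2 else 0.
pose s2 (y z : nat + nat) : nat + nat :=
  match y, z with inr _, inr i => inr (rot i) | _, _ => s y z end.
have s2E y z : ~~ (isr y && isr z) -> s2 y z = s y z by case: y z => [?|?] [?|?].
(* A class missing the hole sends no ordinary point into it: hole points are fixed, and the class
   has order three. *)
have stay y z : ext 2 D y -> ext 3 D z -> ~~ (isr y && isr z) -> ~~ (isr y && isr (s y z)).
  case: y z => [//|j] [x|//] cy pz _ /=; have p1 := odc_in H cy pz.
  apply/negP => r; have := odc_fix H cy p1; have := odc_cube H cy pz.
  rewrite /= r => E /eqP E1; by rewrite !E1 in E; rewrite E in r.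
have F : odc (ext 3 D) (ext 2 D) (fun _ _ => false) (fun x x' => x != x') (fun y y' => y != y') s2.
  have covE y x x' : ~~ (isr y && isr x) -> ~~ (isr y && isr x') ->
      cov (s2 y) x x' = cov (s y) x x' by move=> r r'; rewrite /cov !s2E.
  have cov_mixed j x i : ext 2 D (inr j) -> ext 3 D (inl x) -> ext 3 D (inr i) ->
      cov (s2 (inr j)) (inl x) (inr i) = cov (s (inr j)) (inl x) (inr i).
    move=> cy px pi; rewrite /cov /=; congr (_ || _).
    by have /eqP-> := odc_fix H cy pi.
  have cov_mixed' j x i : ext 2 D (inr j) -> ext 3 D (inl x) -> ext 3 D (inr i) ->
      cov (s2 (inr j)) (inr i) (inl x) = cov (s (inr j)) (inr i) (inl x).
    by move=> *; rewrite /cov orbC [RHS]orbC; exact: cov_mixed.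
  have covN y x x' : ext 2 D y -> ext 3 D x -> ext 3 D x' -> ~~ (isr x && isr x') ->
      cov (s2 y) x x' = cov (s y) x x'.
    case: y x x' => [y|j] [x|i] [x'|i'] //= *; try by apply: covE.
    - exact: cov_mixed.
    - exact: cov_mixed'.
  have hole i i' : i < 3 -> i' < 3 -> i != i' -> (rot i == i') || (rot i' == i).
    by case: i i' => [|[|[|]]] // [|[|[|]]].
  split.
  - move=> y z cy pz; case r: (isr y && isr z); last by rewrite s2E ?r //; exact: odc_in H _ _ cy pz.
    by case: y z cy pz r => [//|j] [//|[|[|[|]]]].
  - move=> y z cy pz; case r: (isr y && isr z); last first.
      have r1 := stay _ _ cy pz (negbT r); have r2 := stay _ _ cy (odc_in H cy pz) r1.
      by rewrite !s2E ?r // (odc_cube H).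
    by case: y z cy pz r => [//|j] [//|[|[|[|]]]].
  - move=> y z cy pz; case r: (isr y && isr z); last by rewrite s2E ?r // (odc_fix H).
    by case: y z cy pz r => [//|j] [//|[|[|[|]]]].
  - move=> x x' px px' ne; case r: (isr x && isr x'); last first.
      have [|y1 [y2 [c1 c2 n12 E]]] := odc_two H px px'; first by rewrite ne r.
      by exists y1, y2; split=> // y cy; rewrite covN ?r // E.
    (* A pair inside the hole is covered by the two classes with the new triple and by no other,
       since it was uncovered before. *)
    exists (inr 0), (inr 1); split=> // y cy.
    case: x x' px px' ne r => [//|i] [//|i'] px px' ne _.
    case: y cy => [a|[|[|]]] cy //=; last 2 first.
    + by rewrite /cov /= hole //; apply: contra ne => /eqP->.
    + by rewrite /cov /= hole //; apply: contra ne => /eqP->.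
    by apply/negbTE; rewrite /cov !s2E ?andbF //; apply: (odc_none H) => //=; rewrite andbF.
  - by move=> y x x' _ _ _ ->.
  - move=> y y' cy cy' ne; case r: (isr y && isr y'); last first.
      have [|x [x' [px px' nx c c']]] := odc_meet H cy cy'; first by rewrite ne r.
      have rx : ~~ (isr x && isr x').
        case: (boolP (isr x && isr x')) => // rx.
        by move: c; apply: contraTT => _; apply: (odc_none H) => //; rewrite rx andbF.
      by exists x, x'; rewrite !covN.
    exists (inr 0), (inr 1); case: y y' r {cy cy' ne} => [//|j] [//|j'] _.
    by split.
(* Hole points 0 and 1 become the ordinary points [g] and [g + 1], and point 2 remains as the single
   hole point. The same map makes both special classes ordinary. *)
pose f (z : nat + nat) : nat + nat := match z with
  inl x => inl x | inr i => if i < 2 then inl (g + i) else inr 0 end.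
pose f' (z : nat + nat) : nat + nat := match z with
  inl x => if x < g then inl x else inr (x - g) | inr _ => inr 2 end.
have fK x : ext 3 D x -> ext 1 (fun x => x < g + 2) (f x) /\ f' (f x) = x.
  case: x => [x|[|[|[|]]]] //=; rewrite /D => xg; rewrite ?xg; split; try lia; by
    rewrite ?ltnNge ?leq_addr //= addKn.
have f'K x : ext 1 (fun x => x < g + 2) x -> ext 3 D (f' x) /\ f (f' x) = x.
  case: x => [x|[|]] //= xg; case: ltnP => gx /=; first by rewrite /D.
  by split; [lia | rewrite (_ : x - g < 2); [congr inl; lia | lia]].
have hK x : ext 2 D x -> ext 0 (fun x => x < g + 2) (f x) /\ f' (f x) = x.
  case: x => [x|[|[|]]] //=; rewrite /D => xg; rewrite ?xg; split; try lia; by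
    rewrite ?ltnNge ?leq_addr //= addKn.
have h'K x : ext 0 (fun x => x < g + 2) x -> ext 2 D (f' x) /\ f (f' x) = x.
  case: x => [x|[|]] //= xg; case: ltnP => gx /=; first by rewrite /D.
  by split; [lia | rewrite (_ : x - g < 2); [congr inl; lia | lia]].
eexists; apply: (odc_transport (f := f) (f' := f') (h := f) (h' := f') fK f'K hK h'K _ _ _ F).
- by move=> [w|w] z.
- move=> z z' pz pz'; have -> : (f' z != f' z') = (z != z').
    congr (~~ _); apply/eqP/eqP => [E|-> //].
    by have [_ <-] := f'K _ pz; rewrite E; have [_ ->] := f'K _ pz'.
  by case: z z' pz pz' => [x|[|]] // [x'|[|]] //; rewrite andbT.
- move=> z z' pz pz'; have -> : (f' z != f' z') = (z != z').
    congr (~~ _); apply/eqP/eqP => [E|-> //].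
    by have [_ <-] := h'K _ pz; rewrite E; have [_ ->] := h'K _ pz'.
  by case: z z' pz pz' => [x|[|]] // [x'|[|]] //; rewrite andbT.
Qed.

(** * From covers to extODCs and codes *)

Section Classes.
Variables (X Y : finType) (s : Y -> X -> X).
Hypothesis H : odc predT predT (fun _ _ => false) (fun x x' => x != x')
  (fun y y' => y != y') s.

Definition block y x : {set X} := [set x; s y x; s y (s y x)].
Definition class_of y : {set {set X}} := block y @: setT.

Let cub y x : s y (s y (s y x)) = x := odc_cube H (x := x) (y := y) isT isT.
Let mov y x : s y x != x.
Proof. by rewrite (odc_fix H (x := x) (y := y)). Qed.

Lemma in_block y x x' : (x' \in block y x) = (x == x') || cov (s y) x x'.
Proof.
rewrite !inE /cov -orbA eq_sym; congr [|| _, _ | _]; first by rewrite eq_sym.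
by apply/eqP/eqP => [->|<-]; rewrite cub.
Qed.

Lemma card_block y x : #|block y x| = 3.
Proof.
have e2 : s y (s y x) != x.
  by apply: contra (mov y x) => /eqP E; rewrite -{2}(cub y x) E.
by rewrite /block setUC cardsU1 cards2 !inE negb_or e2 !(eq_sym x) !mov.
Qed.

Lemma block_step y x : block y (s y x) = block y x.
Proof.
by rewrite /block cub; apply/setP => z; rewrite !inE;
  case: (z == x); case: (z == s y x); case: (z == s y (s y x)).
Qed.

Lemma block_id y x x' : x' \in block y x -> block y x' = block y x.
Proof. by rewrite !inE -orbA => /or3P[] /eqP->; rewrite ?block_step. Qed.

Lemma block_eq y x x' : (block y x == block y x') = (x == x') || cov (s y) x x'.
Proof.
rewrite -in_block; apply/eqP/idP => [->|/block_id-> //]; by rewrite in_block eqxx.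
Qed.

Lemma class_partition y : partition (class_of y) setT.
Proof.
apply/and3P; split.
- rewrite -subTset; apply/subsetP => x _; apply/bigcupP; exists (block y x).
    exact: imset_f.
  by rewrite in_block eqxx.
- apply/trivIsetP => _ _ /imsetP[x _ ->] /imsetP[x' _ ->]; apply: contraR => /pred0Pn[z /andP[/= h h']].
  by rewrite -(block_id h) -(block_id h').
- by apply/imsetP => -[x _ E]; have := card_block y x; rewrite -E cards0.
Qed.

Lemma class_covers y x x' : x != x' -> covers (class_of y) [set x; x'] = cov (s y) x x'.
Proof.
move=> ne; apply/exists_inP/idP => [[_ /imsetP[z _ ->]]|c].
  rewrite subUset !sub1set => /andP[h h'].
  by have := in_block y x x'; rewrite (block_id h) h' (negPf ne).
exists (block y x); first exact: imset_f.
by rewrite subUset !sub1set !in_block eqxx c orbT.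
Qed.

Lemma card_class q y : #|X| = 3 * q -> #|class_of y| = q.
Proof.
move=> cX; have := card_uniform_partition _ (class_partition y); move=> /(_ 3).
rewrite cardsT cX mulnC => /(_ _)/eqP; rewrite eqn_pmul2r // => E; apply/esym/eqP/E.
by move=> _ /imsetP[x _ ->]; exact: card_block.
Qed.

Lemma cov_two x x' : x != x' -> #|[set y | cov (s y) x x']| = 2.
Proof.
move=> ne; have [y1 [y2 [_ _ n12 E]]] := odc_two H (x := x) (x' := x') isT isT ne.
rewrite (_ : [set y | _] = [set y1; y2]) ?cards2 ?n12 //.
by apply/setP => y; rewrite !inE E.
Qed.

(** If two classes had the same triples, a third class would share a pair with one of them, and that
    pair would be covered three times. *)
Lemma class_inj : 3 <= #|Y| -> injective class_of.
Proof.
move=> Y3 y y' E; apply/eqP; apply: contraLR Y3 => ne; rewrite -ltnNge.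
rewrite -cardsT; suff -> : [set: Y] = [set y; y'] by rewrite cards2 ne.
apply/setP => w; rewrite !inE; apply/esym; apply: contraT; rewrite negb_or => /andP[wy wy'].
have nyw : y != w by rewrite eq_sym.
have [x [x' [_ _ nx c c']]] := odc_meet H (y := y) (y' := w) isT isT nyw.
have c2 : cov (s y') x x' by rewrite -class_covers // -E class_covers.
have /eqP := cov_two nx; rewrite (cardsD1 y) (cardsD1 y') (cardsD1 w) !inE c c' c2.
by rewrite ![y' == _]eq_sym ne wy wy'.
Qed.

Lemma odc_extODC q : #|X| = 3 * q -> 3 <= #|Y| ->
  extODC_by q 3 [set class_of y | y : Y].
Proof.
move=> cX Y3; split; last first.
  move=> _ /imsetP[y _ ->]; split; first exact: card_class.
  by move=> _ /imsetP[x _ ->]; exact: card_block.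
split.
- by move=> _ /imsetP[y _ ->]; exact: class_partition.
- move=> _ _ /imsetP[y _ ->] /imsetP[y' _ ->] ne.
  have ny : y != y' by apply: contra ne => /eqP->.
  have [x [x' [_ _ nx c c']]] := odc_meet H (y := y) (y' := y') isT isT ny.
  by exists [set x; x']; rewrite cards2 nx !class_covers.
- move=> T /eqP/cards2P[x [x' [nx ->]]]; rewrite -(cov_two nx).
  rewrite -(card_imset (mem [set y | cov (s y) x x']) (class_inj Y3)); apply: eq_card => P.
  rewrite !inE; apply/andP/imsetP => [[/imsetP[y _ ->]]|[y]].
    by rewrite class_covers // => c; exists y; rewrite ?inE.
  by rewrite inE => c ->; rewrite imset_f // class_covers.
Qed.

(** The words of two points agree exactly at the classes covering the pair, hence in two places; two
    classes sharing a pair realise any prescribed two coordinates. *)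
Lemma odc_armstrong q (n := #|Y|) : #|X| = 3 * q -> 0 < q -> 3 <= #|Y| ->
  exists C : {set n.-tuple 'I_q}, armstrong_code 3 C.
Proof.
move=> cX q0 Y3; case: q q0 cX => // q _ cX.
(* The letter is the number of the block of [x] within the class; [inord] never truncates because a
   class has exactly [q.+1] blocks. *)
pose letter y x : 'I_q.+1 := inord (index (block y x) (enum (class_of y))).
have letE y x x' : (letter y x == letter y x') = (x == x') || cov (s y) x x'.
  have ib z : block y z \in enum (class_of y) by rewrite mem_enum imset_f.
  have lt z : index (block y z) (enum (class_of y)) < q.+1.
    by rewrite -(card_class y cX) cardE index_mem.
  rewrite -block_eq; apply/eqP/eqP => [/(congr1 val)|E]; last by rewrite /letter E.
  by rewrite /= !inordK // => /(congr1 (nth set0 (enum (class_of y)))); rewrite !nth_index.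
pose word x : n.-tuple 'I_q.+1 := [tuple letter (enum_val i) x | i < n].
have agE x x' : x != x' -> agree (word x) (word x') = enum_rank @: [set y | cov (s y) x x'].
  move=> ne; apply/setP => i; rewrite inE !tnth_mktuple letE (negPf ne) /=.
  apply/idP/imsetP => [c|[y]]; first by exists (enum_val i); rewrite ?inE ?enum_valK.
  by rewrite inE => c ->; rewrite enum_rankK.
have agc x x' : x != x' -> #|agree (word x) (word x')| = 2.
  by move=> ne; rewrite agE // card_imset ?cov_two //; exact: enum_rank_inj.
exists [set word x | x : X]; split.
  move=> _ _ /imsetP[x _ ->] /imsetP[x' _ ->] ne.
  have nx : x != x' by apply: contra ne => /eqP->.
  have Eh : ~: agree (word x) (word x') = [set i | tnth (word x) i != tnth (word x') i].
    by apply/setP => i; rewrite !inE.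
  have := cardsC (agree (word x) (word x')); rewrite agc // card_ord Eh.
  rewrite -/(hamming (word x) (word x')); move: (hamming _ _) => hm E.
  by rewrite -[X in X + 1]E; lia.
move=> S /eqP; rewrite subn1 /= => /cards2P[i [j [nij ->]]].
have ny : enum_val i != enum_val j by rewrite (inj_eq enum_val_inj).
have [x [x' [_ _ nx c c']]] := odc_meet H (y := enum_val i) (y' := enum_val j) isT isT ny.
have ag2 : agree (word x) (word x') = [set i; j].
  apply/esym/eqP; rewrite eqEcard agc // cards2 nij leqnn andbT agE //.
  rewrite subUset !sub1set; apply/andP; split; apply/imsetP.
    by exists (enum_val i); rewrite ?inE ?enum_valK.
  by exists (enum_val j); rewrite ?inE ?enum_valK.
exists (word x), (word x'); split=> //; try exact: imset_f.
(* Equal words would agree in all [n >= 3] places, but these agree in two. *)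
apply/eqP => E; have := agc x x' nx; rewrite E.
have -> : agree (word x') (word x') = setT by apply/setP => l; rewrite !inE eqxx.
by rewrite cardsT card_ord => E2; rewrite -/n E2 in Y3.
Qed.
End Classes.

(** * The upper bound on the length *)

(** Cauchy-Schwarz over the naturals, from [2ab <= a^2 + b^2] summed over all pairs of indices. *)
Lemma sum_sqr_ge (I : finType) (c : I -> nat) : (\sum_i c i) ^ 2 <= #|I| * \sum_i c i ^ 2.
Proof.
rewrite -(leq_pmul2l (isT : 0 < 2)) -mulnn big_distrlr /=.
have -> : 2 * (#|I| * \sum_i c i ^ 2) = \sum_i \sum_j (c i ^ 2 + c j ^ 2).
  transitivity (\sum_i (#|I| * c i ^ 2 + \sum_j c j ^ 2)).
    by rewrite big_split /= sum_nat_const -big_distrr mul2n addnn.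
  by apply: eq_bigr => i _; rewrite big_split /= sum_nat_const.
rewrite big_distrr; apply: leq_sum => i _; rewrite big_distrr; apply: leq_sum => j _.
exact: (nat_Cauchy (c i) (c j)).1.
Qed.

Section Bound.
Variables (q n : nat) (C : {set n.-tuple 'I_q}).
Hypothesis arm : armstrong_code 3 C.
Let M := #|C|.

Lemma agree_le x y : x \in C -> y \in C -> x != y -> #|agree x y| <= 2.
Proof.
move=> Cx Cy ne; have := arm.1 x y Cx Cy ne; rewrite /hamming.
have -> : [set i | tnth x i != tnth y i] = ~: agree x y by apply/setP => i; rewrite !inE.
have := cardsC (agree x y); rewrite card_ord; move: #|_| #|_| => a b; lia.
Qed.

Lemma length_le_card : 1 < n -> n <= M.
Proof.
move=> n1; have key : 'C(n, 2) <= 'C(M, 2).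
  rewrite -{1}(card_ord n) -cardsT -!cards_draws.
  (* The map sends a set of words to the coordinates where they all agree. By the second Armstrong
     condition, pairs of words reach every pair of coordinates. *)
  pose f (P : {set n.-tuple 'I_q}) : {set 'I_n} :=
    [set i | [forall x in P, forall y in P, tnth x i == tnth y i]].
  apply: leq_trans (leq_imset_card f _); apply: subset_leq_card; apply/subsetP => S.
  rewrite inE => /andP[_ /eqP cS].
  have [x [y [Cx Cy ne <-]]] := arm.2 S cS.
  apply/imsetP; exists [set x; y].
    by rewrite inE cards2 ne subUset !sub1set Cx Cy.
  apply/setP => i; rewrite !inE; apply/idP/forall_inP => [/eqP E u|h].
    by rewrite !inE => /orP[]/eqP->; apply/forall_inP => v; rewrite !inE => /orP[]/eqP->; rewrite ?E.
  by have /forall_inP := h x (set21 _ _); apply; exact: set22.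
(* With [M < n], monotonicity would give ['C(M.+1, 2) <= 'C(M, 2)], although the two differ by
   [M > 0]. *)
rewrite leqNgt; apply/negP => Mn.
have M1 : 1 < M by rewrite -bin_gt0 (leq_trans _ key) // bin_gt0.
have := leq_trans (leq_bin2l 2 Mn) key; rewrite binS bin1; lia.
Qed.

(** Double counting: two words agree at [i] when they share a letter there, so each letter
    contributes the square of its frequency. *)
Lemma sum_agree : \sum_(x in C) \sum_(y in C) #|agree x y| =
  \sum_(i < n) \sum_(a : 'I_q) #|[set x in C | tnth x i == a]| ^ 2.
Proof.
have agE x y : #|agree x y| = \sum_(i < n) \sum_(a : 'I_q) (tnth x i == a) * (tnth y i == a).
  rewrite -sum1_card big_mkcond; apply: eq_bigr => i _; rewrite inE (bigD1 (tnth x i)) //=.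
  rewrite eqxx mul1n big1 => [|a]; first by rewrite addn0 [tnth y i == _]eq_sym; case: eqP.
  by rewrite eq_sym => /negPf->.
under eq_bigr => x _ do under eq_bigr => y _ do rewrite agE.
under eq_bigr => x _ do rewrite exchange_big /=.
rewrite exchange_big; apply: eq_bigr => i _ /=.
under eq_bigr => x _ do rewrite exchange_big /=.
rewrite exchange_big; apply: eq_bigr => a _ /=.
have -> : #|[set x in C | tnth x i == a]| = \sum_(x in C) (tnth x i == a).
  rewrite -sum1_card -big_mkcondr; apply: eq_bigl => x; by rewrite inE.
by rewrite -mulnn big_distrlr.
Qed.

(** At each coordinate the [q] letter frequencies sum to [M], and Cauchy-Schwarz bounds the
    agreements from below. From above, a word agrees with itself [n] times and with each other word
    at most twice. *)
Lemma length_card_ineq : n * M ^ 2 <= q * (n * M + 2 * (M * M.-1)).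
Proof.
have lower : n * M ^ 2 <= q * \sum_(x in C) \sum_(y in C) #|agree x y|.
  rewrite sum_agree big_distrr -{1}(card_ord n) -sum_nat_const; apply: leq_sum => i _ /=.
  have -> : M = \sum_(a : 'I_q) #|[set x in C | tnth x i == a]|.
    rewrite /M -sum1_card (partition_big (fun x => tnth x i) predT) //=.
    apply: eq_bigr => a _; rewrite -sum1_card; apply: eq_bigl => x; by rewrite inE.
  by rewrite -[X in X * _](card_ord q); exact: sum_sqr_ge.
apply: leq_trans lower _; rewrite leq_mul2l; apply/orP; right.
have -> : n * M + 2 * (M * M.-1) = \sum_(x in C) (n + 2 * M.-1).
  by rewrite sum_nat_const -/M mulnDr [in RHS]mulnCA [M * n]mulnC.
apply: leq_sum => x Cx; rewrite (bigD1 x) //=; apply: leq_add.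
  by rewrite -[n in _ <= n](card_ord n) max_card.
have -> : 2 * M.-1 = \sum_(y in C | y != x) 2.
  rewrite sum_nat_const mulnC; congr (_ * _); rewrite /M (cardD1 x) Cx /=.
  by apply: eq_card => y; rewrite !inE andbC.
by apply: leq_sum => y /andP[Cy ne]; apply: agree_le; rewrite // eq_sym.
Qed.

Lemma armstrong3_length : 0 < q -> n <= 3 * q - 1.
Proof.
move=> q0; rewrite leqNgt; apply/negP => n3q.
have nM : n <= M by apply: length_le_card; lia.
have := length_card_ineq; case: M nM => [|m nM]; first by lia.
rewrite /= (_ : q * _ = m.+1 * (q * (n + 2 * m))); last by lia.
rewrite (_ : n * _ = m.+1 * (n * m.+1)) ?leq_pmul2l; try lia.
(* After cancelling [M = m + 1], the inequality reads [n * (m + 1 - q) <= 2 * q * m]. With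
   [3 * q <= n] this gives [m + 3 <= 3 * q], against [3 * q <= n <= m + 1]. *)
move=> ineq; have : 3 * q * (m.+1 - q) <= n * (m.+1 - q) by rewrite leq_mul2r; lia.
nia.
Qed.
End Bound.

(** * Complete covers for the admissible orders *)

Lemma fillable_odc n : 0 < n -> fillable 1 0 n -> exists s : 'I_n -> 'I_n.+1 -> 'I_n.+1,
  odc predT predT (fun _ _ => false) (fun x x' => x != x') (fun y y' => y != y') s.
Proof.
move=> n0 [s H].
pose f (z : nat + nat) : 'I_n.+1 := if z is inl x then inord x else ord_max.
pose f' (i : 'I_n.+1) : nat + nat := if i < n then inl (i : nat) else inr 0.
pose h' (i : 'I_n) : nat + nat := inl (i : nat).
have fK z : ext 1 (fun x => x < n) z -> predT (f z) /\ f' (f z) = z.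
  case: z => [x|[|]] //= xn; split=> //; first by rewrite /f' inordK ?xn // ltnS ltnW.
  by rewrite /f' /= ltnn.
have f'K i : predT i -> ext 1 (fun x => x < n) (f' i) /\ f (f' i) = i.
  rewrite /f'; case: ltnP => /= ni _; split=> //; apply: val_inj; first by rewrite /= inordK.
  by apply/eqP; rewrite eqn_leq ni -ltnS ltn_ord.
have f'_inj : injective f' by apply: (can_inj (g := f)) => i; exact: (f'K i isT).2.
(* Writing [n] as a successor makes the type of classes inhabited, as the default value of [h]
   requires. *)
case: n => // n in n0 s H f f' h' fK f'K f'_inj *.
pose h (z : nat + nat) : 'I_n.+1 := if z is inl x then inord x else ord0.
exists (fun w z => f (s (h' w) (f' z))).
apply: (odc_transport (f := f) (f' := f') (h := h) (h' := h') fK f'K _ _ _ _ _ H).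
- by case=> [x|//] /= xn; rewrite /h' inordK.
- by move=> i _; rewrite /= ltn_ord inord_val.
- by move=> w z _ _.
- move=> i j _ _; rewrite (inj_eq f'_inj) /f'.
  case: (ltnP i) => ni; case: (ltnP j) => nj; rewrite /= ?andbT //.
  have := ltn_ord i; have := ltn_ord j; rewrite -(inj_eq val_inj) /=; lia.
- by move=> i j _ _; rewrite /= andbT.
Qed.

(** With [n = q - 1], closing the hole gives [3 * n + 2 = 3 * q - 1]. The exceptional [n] correspond
    to [q] = 12, 14, 16, 20, 22, 28, of which 12, 22 and 28 have covers of their own. *)
Lemma fillable_optimal q : 5 <= q -> q \notin [:: 14; 16; 20] -> fillable 1 0 (3 * q - 1).
Proof.
move=> q5 qx.
have close n : good n -> fillable 1 0 (3 * n + 2) by move/good_fillable/fillable_close.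
have [g|] := boolP (good q.-1).
  by rewrite (_ : 3 * q - 1 = 3 * q.-1 + 2); [exact: close | lia].
have : (q == 12) || (q == 22) || (q == 28) || good q.-1.
  by move: qx; rewrite /good !inE; lia.
case/orP=> [/orP[/orP[]|]|-> //] /eqP-> _.
- exact: fillable1_35.
- exact: fillable_2_24_17 fillable1_2 (close 5 isT).
- exact: fillable_2_30_23 fillable1_2 (close 7 isT).
Qed.

Theorem theorem3 (q : nat) (q_ge5 : 5 <= q) (q_exc : q \notin [:: 14; 16; 20]) :
  (exists D : {set {set {set 'I_(3 * q)}}}, extODC_by q 3 D) /\
  armstrong_max q 3 (3 * q - 1).
Proof.
have [|s H] := fillable_odc _ (fillable_optimal q_ge5 q_exc); first by lia.
have q0 : 0 < q by lia.
have Eq : (3 * q - 1).+1 = 3 * q by lia.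
have Y3 : 3 <= #|'I_(3 * q - 1)| by rewrite card_ord; lia.
have cX : #|'I_(3 * q - 1).+1| = 3 * q by rewrite card_ord.
split; last split.
- have : exists D : {set {set {set 'I_(3 * q - 1).+1}}}, extODC_by q 3 D.
    by eexists; exact: (odc_extODC H cX Y3).
  by rewrite Eq.
- by have := odc_armstrong H cX q0 Y3; rewrite card_ord.
- by move=> n C arm; exact: armstrong3_length arm q0.
Qed.
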